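(* There exist constants $c_1,c_2>0$ such that for every $f\in \mathrm{BMOA}(\mathbb T)$ with $\|f\|_{\mathrm{BMOA}}\le 1$, every $\epsilon>0$ and every $\lambda\in\mathbb R^+$ (i.e. $\lambda>0$) there exist $g\in H^\infty(\mathbb T)$ and a measurable set $E\subset\mathbb T$ such that $$\|g\|_\infty\le\lambda,\qquad |f(\theta)-g(\theta)|\le\epsilon\ \text{ for }\theta\in E,\qquad |\mathbb T\setminus E|\le\frac1\epsilon\, e^{-\lambda c_1}c_2 .$$
   Context: $\mathbb T$ is the unit circle and $|\cdot|$ denotes Lebesgue (arc length) measure on $\mathbb T$. $H^\infty(\mathbb T)$ is the space of boundary values on $\mathbb T$ of bounded analytic functions on the unit disk $D$, with the sup norm. $\mathrm{BMOA}(\mathbb T)$ is the space of (boundary values of) functions in the Hardy space $H^1$ whose boundary values have bounded mean oscillation on $\mathbb T$, with the norm $$\|f\|_{\mathrm{BMOA}}=|f(0)|+\sup_{I}\frac1{|I|}\int_I|f-f_I|\,dt,\qquad f_I=\frac1{|I|}\int_I f\,dt,$$ where the supremum is over all intervals (arcs) $I\subset\mathbb T$ and $f(0)$ is the value at $0$ of the analytic extension of $f$ to $D$ (the mean of $f$ over $\mathbb T$). Functions on $\mathbb T$ are identified when they agree almost everywhere. *)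

(* Defs.v *)
From HB Require Import structures.
From mathcomp Require Import all_boot all_order all_algebra.
From mathcomp Require Import all_classical all_reals all_analysis.
From mathcomp Require Import ess_sup_inf complex.

Set Implicit Arguments.
Unset Strict Implicit.
Unset Printing Implicit Defensive.

Import Order.TTheory GRing.Theory Num.Theory.
Import numFieldNormedType.Exports.

Local Open Scope classical_set_scope.
Local Open Scope ring_scope.

(* MathComp and MathComp-Analysis.  [R] is any [realType] and [R[i]] its
   complexification.  A function on the circle is a map [f : R[i] -> R[i]] of
   which only the restriction to [circle] is used; integrals over the circle
   are integrals of [fun t => f (cis t)] for the Lebesgue measure on [R]. *)

Notation cabs := ComplexField.Normc.normc (only parsing).

Section Circle.
Variable R : realType.
Implicit Types (t a b r : R) (z : R[i]) (f g F : R[i] -> R[i]) (A : set R[i]).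

Definition cis t : R[i] := Complex (cos t) (sin t).

Definition disk : set R[i] := [set z | cabs z < 1].

Definition circle : set R[i] := [set z | cabs z = 1].

Definition circle_measurable A :=
  A `<=` circle /\ measurable [set t : R | A (cis t)].

Definition arc_length A : \bar R :=
  lebesgue_measure (`[0, 2 * pi[ `&` [set t : R | A (cis t)]).

(* The topology on [R[i]] is that of its norm as a field, so this is complex
   differentiability at every point of the disk. *)
Definition analytic_on_disk F :=
  forall z, disk z -> derivable (F : R[i]^o -> R[i]^o) z 1.

(* Elements of function spaces on the circle are classes modulo equality almost
   everywhere; each class has a Borel representative, and only these are used.
   "For almost every t in R" is "almost everywhere on the circle", by
   periodicity of [cis]. *)
Definition boundary_value F f :=
  [/\ measurable_fun setT (fun t => complex.Re (f (cis t))),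
      measurable_fun setT (fun t => complex.Im (f (cis t))) &
      {ae @lebesgue_measure R, forall t,
         (F (Complex r 0 * cis t) : R[i]^o) @[r --> (1 : R)^'-]
           --> (f (cis t) : R[i]^o)}].

Definition hardy_infty F :=
  analytic_on_disk F /\ exists M : R, forall z, disk z -> cabs (F z) <= M.

Definition hardy1 F :=
  analytic_on_disk F /\
  (ereal_sup [set ((2 * pi)^-1)%:E *
                  \int[lebesgue_measure]_(t in `[0%R, (2 * pi)%R])
                     (cabs (F (Complex r 0 * cis t)))%:E
             | r in `[0%R, 1%R[ ] < +oo)%E.

Definition Hinfty f := exists2 F, hardy_infty F & boundary_value F f.

(* The function [fun t => f (cis t)] is periodic, so its essential supremum
   over [R] is the essential supremum of [f] over the circle. *)
Definition Hinfty_norm f : \bar R :=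
  ess_sup (@lebesgue_measure R) (fun t => (cabs (f (cis t)))%:E).

(* The arc is [cis @` `[a, b]], of length [b - a]. *)
Definition arc_mean f a b : R[i] :=
  Complex ((b - a)^-1 *
             \int[lebesgue_measure]_(t in `[a, b]) complex.Re (f (cis t)))
          ((b - a)^-1 *
             \int[lebesgue_measure]_(t in `[a, b]) complex.Im (f (cis t))).

Definition mean_oscillation f a b : \bar R :=
  (((b - a)^-1)%:E *
   \int[lebesgue_measure]_(t in `[a, b])
      (cabs (f (cis t) - arc_mean f a b))%:E)%E.

Definition bmo_seminorm f : \bar R :=
  ereal_sup [set mean_oscillation f ab.1 ab.2
            | ab in [set ab : R * R | ab.1 < ab.2 <= ab.1 + 2 * pi]].

Definition BMOA f :=
  (exists2 F, hardy1 F & boundary_value F f) /\ (bmo_seminorm f < +oo)%E.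

(* Analytic extension of [f] to the disk; it is the zero function if [f] is
   not the boundary value of a function of the Hardy space H^1. *)
Definition analytic_extension f : R[i] -> R[i] :=
  xget (fun=> 0) [set F | hardy1 F /\ boundary_value F f].

Definition BMOA_norm f : \bar R :=
  ((cabs (analytic_extension f 0))%:E + bmo_seminorm f)%E.

End Circle.

(* Main.v *)
Require Import Defs.
From mathcomp Require Import all_boot all_order all_algebra.
From mathcomp Require Import all_classical all_reals all_analysis.
From mathcomp Require Import complex.
From mathcomp Require Import measurable_realfun ess_sup_inf ring lra.

(* Replace [f] by a dilation [p = F (r _)] of its analytic extension, which is analytic
   across the circle and close to [f] off a small set.  If [G] is analytic across the circle,
   [Re G >= 0] and [Re G >= (sqrt (|p| / lambda) - 1)^+] on the circle, then
   [g = p / (1 + G) ^ 2] satisfies [|g| <= lambda] there, and [|p - g| <= 3 lambda |G|] where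
   [|G| <= 1].  Such a [G] is obtained, with [G 0] close to the mean of
   [(sqrt (|p| / lambda) - 1)^+], by discretizing the Herglotz integral; the weak type
   inequality then bounds the measure of the set where [|G| >= s] by a multiple of [G 0 / s].
   That mean is [O (exp (- c lambda) / lambda)] by the John-Nirenberg inequality for [f], once
   the means of [|F (r _)| ^ (1/2)] are known to converge: the dilations are bounded in [L^1],
   so their square roots are uniformly integrable.  The same [G], for [F (r _)] minus
   the mean [m] of [f], bounds [|F 0 - m|]; hence [m] is bounded and [f] itself has
   exponential moments.  For [eps > 6 lambda], [g = 0] suffices. *)

(** The exponent 2 in [p / (1 + G) ^ 2] is dictated by the passage from the dilations to [f]. With a
    single factor [1 + G], the data for [G] would grow linearly in [|p|], and boundedness in [L^1]
    alone does not control the limit of the means of such a function; it does for a function that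
    grows like a square root. The price is small: [p - g] is [g * G * (G + 2)], still of order [|G|]
    where [|G| <= 1]. The factor [1 / eps] of the estimate comes from the weak type inequality at
    the level [s = eps / (6 lambda)]: its [1 / s] cancels the [1 / lambda] in the mean of the excess
    and leaves [exp (- c lambda) / eps]. The restriction [s <= 1] is what separates the case
    [eps > 6 lambda]. The norm bounds [F 0], while the John-Nirenberg inequality is about [f - m];
    this is why the two numbers have to be compared. Analyticity is pointwise complex
    differentiability, so the mean value property is derived by a bisection argument that
    presupposes no continuity of the derivative. *)

Set Implicit Arguments.
Unset Strict Implicit.
Unset Printing Implicit Defensive.

Import Order.TTheory GRing.Theory Num.Theory.
Import numFieldNormedType.Exports.

Local Open Scope classical_set_scope.
Local Open Scope ring_scope.

(** * The complex plane *)

Section ComplexDerivative.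
Variable R : realType.
Implicit Types (z h l w : R[i]) (F G : R[i] -> R[i]).

Lemma cabs_ge0 z : 0 <= cabs z.
Proof. by case: z => a b; rewrite /= sqrtr_ge0. Qed.

Lemma normr_cabs z : `|z| = (cabs z)%:C%C.
Proof. by rewrite normc_def; case: z. Qed.

Lemma cabs0 : cabs (0 : R[i]) = 0.
Proof. exact: ComplexField.Normc.normc0. Qed.

Lemma cabs1 : cabs (1 : R[i]) = 1.
Proof. exact: ComplexField.Normc.normc1. Qed.

Lemma cabsM z w : cabs (z * w) = cabs z * cabs w.
Proof. exact: ComplexField.Normc.normcM. Qed.

Lemma cabsV z : cabs z^-1 = (cabs z)^-1.
Proof. exact: ComplexField.Normc.normcV. Qed.

Lemma cabsN z : cabs (- z) = cabs z.
Proof. exact: complex.normcN. Qed.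

Lemma cabsD z w : cabs (z + w) <= cabs z + cabs w.
Proof. exact: complex.le_normcD. Qed.

Lemma cabsB z w : cabs (z - w) <= cabs z + cabs w.
Proof. by rewrite -(cabsN w) cabsD. Qed.

Lemma cabs_Re z : `|complex.Re z| <= cabs z.
Proof.
by have := normc_ge_Re z; rewrite normr_cabs lecR.
Qed.

Lemma cabs_Im z : `|complex.Im z| <= cabs z.
Proof.
case: z => a b /=; rewrite -[X in X <= _]sqrtr_sqr ler_wsqrtr//.
by rewrite lerDr sqr_ge0.
Qed.

Lemma cabs_le_ReIm z : cabs z <= `|complex.Re z| + `|complex.Im z|.
Proof.
case: z => a b /=.
rewrite -(@ger0_norm _ (`|a| + `|b|)) ?addr_ge0// -sqrtr_sqr ler_wsqrtr//.
rewrite sqrrD !real_normK ?num_real// [leRHS]addrAC lerDl.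
by rewrite mulrn_wge0// mulr_ge0.
Qed.

Lemma cabs_cis (t : R) : cabs (cis t) = 1.
Proof. by rewrite /cis /= cos2Dsin2 sqrtr1. Qed.

Lemma cabs_real (x : R) : cabs (Complex x 0) = `|x|.
Proof. by rewrite /= expr0n addr0 sqrtr_sqr. Qed.

(** A form without quotients and with real tolerances: the norm of [R[i]] takes values in [R[i]],
    whereas estimates are carried out in [R] through [cabs]. *)
Definition is_cderiv F z l := forall e : R, 0 < e ->
  exists2 d : R, 0 < d & forall h, cabs h < d ->
    cabs (F (z + h) - F z - l * h) <= e * cabs h.

(** The order of [R[i]] compares only numbers with equal imaginary parts, so the radii and
    tolerances of its topology are real. *)
Lemma gt0_complex (e : R[i]) : 0 < e -> exists2 x : R, 0 < x & e = x%:C%C.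
Proof.
case: e => a b; rewrite ltcE /= => /andP[/eqP -> a0]; by exists a.
Qed.

Lemma derivable_cderivP F z :
  derivable (F : R[i]^o -> R[i]^o) z 1 <-> exists l, is_cderiv F z l.
Proof.
split.
  move=> /cvg_ex[/= l]; move/cvgrPdist_le => H; exists l => e e0.
  have e0' : 0 < e%:C%C by rewrite ltcR.
  have := H _ e0'; rewrite near_withinE.
  move/nbhs_ballP => [d /= /gt0_complex[x x0 ->] Hd].
  exists x => // h hx.
  have [->|h0] := eqVneq h 0.
    by rewrite mulr0 !addr0 subrr subr0 cabs0 mulr0.
  have := Hd h; rewrite /ball /= sub0r normrN normr_cabs ltcR hx => /(_ isT h0).
  rewrite [h%:A]/GRing.scale /= mulr1 => H1.
  have -> : F (z + h) - F z - l * h = - (h * (l - h^-1 * (F (h + z) - F z))).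
    by rewrite addrC (addrC h); field.
  rewrite cabsN cabsM mulrC ler_wpM2r ?cabs_ge0//.
  by rewrite -lecR -normr_cabs.
move=> [l Hl]; apply/cvg_ex; exists l; apply/cvgrPdist_le => e /gt0_complex[x x0 ->].
have [d d0 Hd] := Hl x x0.
rewrite near_withinE; apply/nbhs_ballP; exists d%:C%C => /=; first by rewrite ltcR.
move=> h; rewrite /ball /= sub0r normrN normr_cabs ltcR => hd h0.
rewrite [h%:A]/GRing.scale /= mulr1.
have := Hd h hd.
have -> : F (z + h) - F z - l * h = - (h * (l - h^-1 * (F (h + z) - F z))).
  by rewrite addrC (addrC h); field.
rewrite cabsN cabsM mulrC.
rewrite ler_pM2r; first by rewrite normr_cabs lecR.
rewrite lt_neqAle cabs_ge0 andbT eq_sym.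
by apply: contra_neq h0 => /ComplexField.Normc.eq0_normc.
Qed.

End ComplexDerivative.

(** * Continuity, and compactness of the closed disk *)

Section ComplexTopology.
Variable R : realType.
Implicit Types (z h l w : R[i]) (F G : R[i] -> R[i]).

Lemma cvg_complexP (T : Type) (Fl : set_system T) {FF : Filter Fl}
    (f : T -> R[i]) z :
  ((f : T -> R[i]^o) x @[x --> Fl] --> (z : R[i]^o)) <->
  ((complex.Re (f x) @[x --> Fl] --> complex.Re z) /\
   (complex.Im (f x) @[x --> Fl] --> complex.Im z)).
Proof.
split.
  move=> /cvgrPdist_le H; split; apply/cvgrPdist_le => e e0.
    have e0' : 0 < e%:C%C by rewrite ltcR.
    apply: filterS (H _ e0') => x.
    by rewrite normr_cabs lecR; apply: le_trans; rewrite -raddfB cabs_Re.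
  have e0' : 0 < e%:C%C by rewrite ltcR.
  apply: filterS (H _ e0') => x.
  by rewrite normr_cabs lecR; apply: le_trans; rewrite -raddfB cabs_Im.
move=> [/cvgrPdist_le H1 /cvgrPdist_le H2]; apply/cvgrPdist_le => _ /gt0_complex[e e0 ->].
have e2 : 0 < e / 2 by rewrite divr_gt0.
apply: filterS2 (H1 _ e2) (H2 _ e2) => x h1 h2.
rewrite normr_cabs lecR; apply: le_trans (cabs_le_ReIm _) _.
by rewrite !raddfB (splitr e) lerD.
Qed.

Lemma cvg_cabs (T : Type) (Fl : set_system T) {FF : Filter Fl}
    (f : T -> R[i]) z :
  (f : T -> R[i]^o) x @[x --> Fl] --> (z : R[i]^o) ->
  cabs (f x) @[x --> Fl] --> cabs z.
Proof.
move=> /(@cvg_norm _ R[i]^o _ _ _ _ _); under eq_fun do rewrite normr_cabs.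
by rewrite normr_cabs => /cvg_complexP[].
Qed.

Lemma continuous_cabs : continuous (fun z : R[i]^o => cabs z).
Proof. by move=> z; apply: (@cvg_cabs _ (nbhs (z : R[i]^o)) _ id). Qed.

Lemma continuous_cis : continuous (@cis R : R -> R[i]^o).
Proof.
move=> t; apply/cvg_complexP; split => /=;
 [exact: continuous_cos|exact: continuous_sin].
Qed.

Lemma cderivable_continuous F z :
  derivable (F : R[i]^o -> R[i]^o) z 1 ->
  {for z, continuous (F : R[i]^o -> R[i]^o)}.
Proof. by move=> /derivable1_diffP /differentiable_continuous. Qed.

(** Compactness is transported from a closed part of the square in [R * R] by the continuous map
    from pairs to complex numbers. *)
Lemma closed_disk_compact : compact ([set z | cabs z <= 1] : set R[i]^o).
Proof.
pose g (p : R * R) : R[i]^o := Complex p.1 p.2.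
have gc : continuous g.
  move=> p; apply/cvg_complexP; split => /=; [exact: cvg_fst|exact: cvg_snd].
pose A := (`[(-1 : R), 1] `*` `[(-1 : R), 1]) `&` (g @^-1` [set z | cabs z <= 1]).
have cA : compact A.
  apply: compact_closedI; first by apply: compact_setX; exact: segment_compact.
  apply: (@preimage_closed _ _ g _ (fun x _ => gc x)).
  have -> : ([set z | cabs z <= 1] : set R[i]^o) =
      (fun z : R[i]^o => cabs z) @^-1` [set x : R | x <= 1] by [].
  apply: preimage_closed; last exact: closed_le.
  by move=> x _; exact: continuous_cabs.
have -> : ([set z | cabs z <= 1] : set R[i]^o) = g @` A.
  apply/seteqP; split => [z /= z1|_ [p [_ p1] <-] //].
  exists (complex.Re z, complex.Im z); last by case: (z).
  split; last by rewrite /= /g /=; case: (z) z1.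
  by split; rewrite /= in_itv /= -ler_norml (le_trans _ z1)// ?cabs_Re ?cabs_Im.
apply: continuous_compact => //.
by apply: continuous_subspaceT.
Qed.

(** Compactness in its covering form, for the filter of large [M]: a bound valid near each point
    holds on the whole disk once [M] is large enough. *)
Lemma closed_disk_bounded F :
  (forall z, cabs z <= 1 -> {for z, continuous (F : R[i]^o -> R[i]^o)}) ->
  exists M : R, forall z, cabs z <= 1 -> cabs (F z) <= M.
Proof.
move=> Fc; have /compact_near_coveringP/near_covering_withinP := closed_disk_compact.
move=> /(_ R (pinfty_nbhs R) (fun M z => cabs (F z) <= M) _) H.
have : \forall M \near +oo, forall z, cabs z <= 1 -> cabs (F z) <= M.
  apply: H => z z1.
  have /cvg_cabs/cvgrPdist_le/(_ 1 ltr01) := Fc _ z1.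
  move=> H1; exists ([set z' : R[i]^o | `|cabs (F z) - cabs (F z')| <= 1],
    [set M : R | cabs (F z) + 1 <= M]).
    by split => //=; exact: nbhs_pinfty_ge (num_real _).
  move=> [z' M] /= [h1 h2] _; apply: le_trans h2.
  by move: h1; rewrite distrC ler_norml lerBlDl => /andP[].
by move=> [M [_ HM]]; exists (M + 1) => z z1; apply: HM => //; rewrite ltrDl.
Qed.

(** The same covering argument, for the filter of small positive [d]. *)
Lemma closed_disk_unif_continuous (U : R[i]^o -> R) :
  (forall z, cabs z <= 1 -> {for z, continuous U}) ->
  forall e, 0 < e -> exists2 d : R, 0 < d & forall z w,
    cabs z <= 1 -> cabs w <= 1 -> cabs (z - w) <= d -> `|U z - U w| <= e.
Proof.
move=> Uc e e0.
have /compact_near_coveringP/near_covering_withinP := closed_disk_compact.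
move=> /(_ R (0^'+) (fun d z => forall w, cabs w <= 1 -> cabs (z - w) <= d -> `|U z - U w| <= e) _) H.
have : \forall d \near 0^'+, forall z, cabs z <= 1 ->
    forall w, cabs w <= 1 -> cabs (z - w) <= d -> `|U z - U w| <= e.
  apply: H => z z1.
  have e2 : 0 < e / 2 by rewrite divr_gt0.
  have /cvgrPdist_le/(_ _ e2) := Uc _ z1.
  move=> /nbhs_ballP[_ /= /gt0_complex [r r0 ->] Hr].
  have r2 : 0 < r / 2 by rewrite divr_gt0.
  exists ([set z' : R[i]^o | cabs (z - z') < r / 2], [set d | d < r / 2]).
    split => /=; last exact: nbhs_right_lt.
    apply/nbhs_ballP; exists (r / 2)%:C%C; first by rewrite /= ltcR.
    by move=> w; rewrite /ball /= normr_cabs ltcR.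
  move=> [z' d] /= [h1 h2] _ w w1 zw.
  rewrite (splitr e) (le_trans (ler_distD (U z) _ _))// lerD//.
    rewrite distrC; apply: Hr; rewrite /ball /= normr_cabs ltcR.
    by apply: lt_trans h1 _; lra.
  apply: Hr; rewrite /ball /= normr_cabs ltcR.
  rewrite (_ : z - w = (z - z') + (z' - w)); last by ring.
  by apply: le_lt_trans (cabsD _ _) _; lra.
move=> Hd; have [d [d0 {}Hd]] := filter_ex (filterI (nbhs_right_gt (0 : R)) Hd).
by exists d => // z w z1 w1; exact: Hd.
Qed.

End ComplexTopology.

(** * Goursat's theorem and the mean value property *)

Section RealIntegral.
Variable R : realType.
Notation mu := (@lebesgue_measure R).
Implicit Types (f g : R -> R) (a b : R).

Lemma continuous_itv_integrable f a b :
  (forall x, a <= x <= b -> {for x, continuous f}) ->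
  mu.-integrable `[a, b] (EFin \o f).
Proof.
move=> fc; apply: continuous_compact_integrable; first exact: segment_compact.
apply: continuous_in_subspaceT => x; rewrite inE /= in_itv /=; exact: fc.
Qed.

Lemma lebesgue_itvcc a b : a <= b -> mu `[a, b] = (b - a)%:E.
Proof. by move=> ab; rewrite lebesgue_measure_itv /= lte_fin; case: ltgtP ab => // ->; rewrite subrr. Qed.

Lemma Rintegral_itv_cst a b k : a <= b ->
  \int[mu]_(x in `[a, b]) k = k * (b - a).
Proof. by move=> ab; rewrite Rintegral_cst// (congr1 fine (lebesgue_itvcc ab)). Qed.

Lemma Rintegral_split f a m b :
  a <= m -> m <= b -> mu.-integrable `[a, b] (EFin \o f) ->
  \int[mu]_(x in `[a, b]) f x =
  \int[mu]_(x in `[a, m]) f x + \int[mu]_(x in `[m, b]) f x.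
Proof.
move=> am mb fi.
have mb' : mu.-integrable `[m, b] (EFin \o f).
  by apply: integrableS fi => //; apply: subset_itvr; rewrite bnd_simp.
have := @Rintegral_itvB R f (BLeft a) (BRight b) m fi.
rewrite !bnd_simp => /(_ am mb) /eqP; rewrite subr_eq => /eqP ->.
rewrite addrC; congr (_ + _); apply: Rintegral_itv_obnd_cbnd.
by apply: integrableS mb' => //; apply: subset_itvr; rewrite bnd_simp.
Qed.

Lemma Rintegral_close f a b k e : a <= b ->
  mu.-integrable `[a, b] (EFin \o f) ->
  (forall x, a <= x <= b -> `|f x - k| <= e) ->
  `|\int[mu]_(x in `[a, b]) f x - k * (b - a)| <= e * (b - a).
Proof.
move=> ab fi fk.
have ki : mu.-integrable `[a, b] (EFin \o cst k).
  by apply: continuous_itv_integrable => x _; exact: cst_continuous.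
have ei : mu.-integrable `[a, b] (EFin \o cst e).
  by apply: continuous_itv_integrable => x _; exact: cst_continuous.
rewrite -Rintegral_itv_cst// -RintegralB// -[leRHS]Rintegral_itv_cst//.
apply: (le_trans (le_normr_Rintegral _ _)) => //.
  by have := integrableB _ fi ki; apply.
apply: le_Rintegral => //.
  by have := integrable_norm (integrableB _ fi ki); apply.
Qed.

End RealIntegral.

Lemma norm_diff_close (R : realType) (u v c l l' e : R) :
  `|u - c - l| <= e -> `|v - c - l'| <= e -> `|v - u - (l' - l)| <= 2 * e.
Proof.
by rewrite !ler_norml => /andP[? ?] /andP[? ?]; apply/andP; split; lra.
Qed.

Section Goursat.
Variable R : realType.
Notation mu := (@lebesgue_measure R).
Variables (P Q : R -> R -> R) (a b c d : R).
Hypothesis ab : a <= b.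
Hypothesis cd : c <= d.

(* The form [P dx + Q dy] is pointwise differentiable and closed; its partial derivatives
   need not be continuous. *)
Hypothesis closedPQ : forall x y, a <= x <= b -> c <= y <= d ->
  exists p q r : R, forall e : R, 0 < e -> exists2 k : R, 0 < k &
    forall s t, `|s| <= k -> `|t| <= k ->
      `|P (x + s) (y + t) - P x y - (p * s + q * t)| <= e * (`|s| + `|t|) /\
      `|Q (x + s) (y + t) - Q x y - (q * s + r * t)| <= e * (`|s| + `|t|).

Lemma continuous_lin_approx (f : R -> R) x k : (exists2 d : R, 0 < d &
  forall s, `|s| <= d -> `|f (x + s) - f x| <= k * `|s|) -> {for x, continuous f}.
Proof.
move=> [e e0 H]; apply/cvgrPdist_le => eps eps0.
pose K := `|k| + 1.
have K0 : 0 < K by rewrite ltr_wpDl.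
apply/nbhs_ballP; exists (Num.min e (eps / K)) => /=; first by rewrite lt_min e0 divr_gt0.
move=> y; rewrite /ball /= lt_min distrC => /andP[y1 y2].
have := H (y - x) (ltW y1); rewrite subrKC distrC => /le_trans; apply.
apply: (@le_trans _ _ (K * `|y - x|)).
  by rewrite ler_wpM2r// (le_trans (ler_norm _))// lerDl.
by rewrite mulrC -ler_pdivlMr// ltW.
Qed.

Lemma closed_form_lipschitz x y : a <= x <= b -> c <= y <= d ->
  exists K k : R, 0 < k /\ forall s t, `|s| <= k -> `|t| <= k ->
      `|P (x + s) (y + t) - P x y| <= K * (`|s| + `|t|) /\
      `|Q (x + s) (y + t) - Q x y| <= K * (`|s| + `|t|).
Proof.
move=> hx hy; have [p [q [r H]]] := closedPQ hx hy.
have [k k0 {}H] := H 1 ltr01.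
exists (1 + `|p| + `|q| + `|r|), k; split => // s t sk tk.
have [H1 H2] := H s t sk tk.
have ps u v : `|u * s + v * t| <= `|u| * `|s| + `|v| * `|t|.
  by rewrite -!normrM ler_normD.
have s0 := normr_ge0 s; have t0 := normr_ge0 t.
have p0 := normr_ge0 p; have q0 := normr_ge0 q; have r0 := normr_ge0 r.
split.
  have := ler_normD (P (x + s) (y + t) - P x y - (p * s + q * t)) (p * s + q * t).
  rewrite subrK => /le_trans; apply.
  apply: le_trans (lerD H1 (ps _ _)) _; nra.
have := ler_normD (Q (x + s) (y + t) - Q x y - (q * s + r * t)) (q * s + r * t).
rewrite subrK => /le_trans; apply.
apply: le_trans (lerD H2 (ps _ _)) _; nra.
Qed.

Lemma closed_form_continuousP x y : a <= x <= b -> c <= y <= d ->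
  {for x, continuous (P^~ y)}.
Proof.
move=> hx hy; have [K [k [k0 H]]] := closed_form_lipschitz hx hy.
apply: (@continuous_lin_approx _ _ K); exists k => // s sk.
have z0 : `|0 : R| <= k by rewrite normr0 ltW.
by have [+ _] := H s 0 sk z0; rewrite normr0 !addr0.
Qed.

Lemma closed_form_continuousQ x y : a <= x <= b -> c <= y <= d ->
  {for y, continuous (Q x)}.
Proof.
move=> hx hy; have [K [k [k0 H]]] := closed_form_lipschitz hx hy.
apply: (@continuous_lin_approx _ _ K); exists k => // s sk.
have z0 : `|0 : R| <= k by rewrite normr0 ltW.
by have [_] := H 0 s z0 sk; rewrite normr0 !addr0 add0r.
Qed.

(** The integral of [P dx + Q dy] counterclockwise around the boundary of the rectangle [[x, x'] *
    [y, y']]. *)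
Let circulation x x' y y' : R :=
  \int[mu]_(t in `[y, y']) Q x' t - \int[mu]_(t in `[y, y']) Q x t
  - (\int[mu]_(s in `[x, x']) P s y' - \int[mu]_(s in `[x, x']) P s y).

Lemma integrable_closed_formQ x y y' : a <= x <= b -> c <= y -> y' <= d ->
  mu.-integrable `[y, y'] (EFin \o Q x).
Proof.
move=> hx hy hy'; apply: continuous_itv_integrable => t /andP[t1 t2].
by apply: closed_form_continuousQ => //; rewrite (le_trans hy)// (le_trans t2).
Qed.

Lemma integrable_closed_formP y x x' : c <= y <= d -> a <= x -> x' <= b ->
  mu.-integrable `[x, x'] (EFin \o P^~ y).
Proof.
move=> hx hy hy'; apply: continuous_itv_integrable => t /andP[t1 t2].
by apply: closed_form_continuousP => //; rewrite (le_trans hy)// (le_trans t2).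
Qed.

(** Each inner edge is traversed twice, in opposite directions. *)
Lemma circulation_split x x' y y' m n :
  a <= x -> x <= m -> m <= x' -> x' <= b ->
  c <= y -> y <= n -> n <= y' -> y' <= d ->
  circulation x x' y y' =
  (circulation x m y n + circulation m x' y n) +
  (circulation x m n y' + circulation m x' n y').
Proof.
move=> ax xm mx' xb cy yn ny' yd; rewrite /circulation.
have [h1 h2 h3] : [/\ a <= x <= b, a <= m <= b & a <= x' <= b].
  by split; apply/andP; split; lra.
have [k1 k2 k3] : [/\ c <= y <= d, c <= n <= d & c <= y' <= d].
  by split; apply/andP; split; lra.
rewrite !(@Rintegral_split _ (Q _) y n y')//; try by exact: integrable_closed_formQ.
rewrite !(@Rintegral_split _ (P^~ _) x m x')//; try by exact: integrable_closed_formP.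
by ring.
Qed.

(** The linear part has no circulation: since [P] and [Q] share the coefficient [q], both pairs of
    opposite sides contribute [q * w * h]. What remains is the error, at most [2 * e * (w + h)]
    along each pair of sides. *)
Lemma circulation_local x y e k p q r x1 w y1 h :
  0 <= w -> 0 <= h -> w <= k -> h <= k -> 0 <= e ->
  (forall s t, `|s| <= k -> `|t| <= k ->
      `|P (x + s) (y + t) - P x y - (p * s + q * t)| <= e * (`|s| + `|t|) /\
      `|Q (x + s) (y + t) - Q x y - (q * s + r * t)| <= e * (`|s| + `|t|)) ->
  a <= x1 -> x1 + w <= b -> c <= y1 -> y1 + h <= d ->
  x1 <= x <= x1 + w -> y1 <= y <= y1 + h ->
  `|circulation x1 (x1 + w) y1 (y1 + h)| <= 2 * e * (w + h) ^+ 2.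
Proof.
move=> w0 h0 wk hk e0 H ax xb cy yd /andP[x1x xx1] /andP[y1y yy1].
have loc s t : x1 <= s <= x1 + w -> y1 <= t <= y1 + h ->
    `|P s t - P x y - (p * (s - x) + q * (t - y))| <= e * (w + h) /\
    `|Q s t - Q x y - (q * (s - x) + r * (t - y))| <= e * (w + h).
  move=> /andP[s1 s2] /andP[t1 t2].
  have sw : `|s - x| <= w by rewrite ler_norml; apply/andP; split; lra.
  have th : `|t - y| <= h by rewrite ler_norml; apply/andP; split; lra.
  have [] := H (s - x) (t - y) (le_trans sw wk) (le_trans th hk).
  rewrite !subrKC => H1 H2; split;
  by [apply: le_trans H1 _; rewrite ler_wpM2l// lerD|apply: le_trans H2 _; rewrite ler_wpM2l// lerD].
have x1in : x1 <= x1 <= x1 + w by rewrite lexx lerDl.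
have x2in : x1 <= x1 + w <= x1 + w by rewrite lexx lerDl w0.
have y1in : y1 <= y1 <= y1 + h by rewrite lexx lerDl.
have y2in : y1 <= y1 + h <= y1 + h by rewrite lexx lerDl h0.
have x1ab : a <= x1 <= b by rewrite ax (le_trans _ xb)// lerDl.
have x2ab : a <= x1 + w <= b by rewrite xb (le_trans ax)// lerDl.
have y1cd : c <= y1 <= d by rewrite cy (le_trans _ yd)// lerDl.
have y2cd : c <= y1 + h <= d by rewrite yd (le_trans cy)// lerDl.
have iQ1 := integrable_closed_formQ x1ab cy yd.
have iQ2 := integrable_closed_formQ x2ab cy yd.
have iP1 := integrable_closed_formP y1cd ax xb.
have iP2 := integrable_closed_formP y2cd ax xb.
have HQ : `|\int[mu]_(t in `[y1, y1 + h]) (Q (x1 + w) t - Q x1 t) - (q * w) * h|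
    <= (2 * e * (w + h)) * h.
  have := @Rintegral_close R (fun t => Q (x1 + w) t - Q x1 t) y1 (y1 + h) (q * w) (2 * e * (w + h)).
  rewrite addrAC subrr add0r; apply; first by rewrite lerDl.
    by have := integrableB _ iQ2 iQ1; apply.
  move=> t ht; have [_ A] := loc _ _ x1in ht; have [_ B] := loc _ _ x2in ht.
  by have := norm_diff_close A B; rewrite mulrA; congr (`|_ - _| <= _); ring.
have HP : `|\int[mu]_(s in `[x1, x1 + w]) (P s (y1 + h) - P s y1) - (q * h) * w|
    <= (2 * e * (w + h)) * w.
  have := @Rintegral_close R (fun s => P s (y1 + h) - P s y1) x1 (x1 + w) (q * h) (2 * e * (w + h)).
  rewrite addrAC subrr add0r; apply; first by rewrite lerDl.
    by have := integrableB _ iP2 iP1; apply.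
  move=> t ht; have [A _] := loc _ _ ht y1in; have [B _] := loc _ _ ht y2in.
  by have := norm_diff_close A B; rewrite mulrA; congr (`|_ - _| <= _); ring.
rewrite /circulation -!RintegralB//.
rewrite (_ : 2 * e * (w + h) ^+ 2 = 2 * e * (w + h) * h + 2 * e * (w + h) * w); last by ring.
apply: (le_trans (ler_distD (q * w * h) _ _)); rewrite lerD//.
by rewrite distrC mulrAC.
Qed.

(* Bisection: of the four quarters of a bad rectangle one is bad, and the closed form is too
   close to a linear one near the common point of a nested sequence of bad rectangles. *)
Lemma goursat_rectangle : circulation a b c d = 0.
Proof.
apply/eqP; rewrite -normr_le0; apply/ler_addgt0Pl.
suff H (eta : R) : 0 < eta -> `|circulation a b c d| <= eta by move=> e e0; rewrite addr0 H.
move=> eta0.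
rewrite leNgt; apply/negP => bad0.
pose w n := (b - a) / 2 ^+ n; pose h n := (d - c) / 2 ^+ n.
have w0 n : 0 <= w n by rewrite divr_ge0 ?exprn_ge0// subr_ge0.
have h0 n : 0 <= h n by rewrite divr_ge0 ?exprn_ge0// subr_ge0.
have wS n : w n = w n.+1 + w n.+1.
  by rewrite /w exprS; field; rewrite expf_neq0.
have hS n : h n = h n.+1 + h n.+1.
  by rewrite /h exprS; field; rewrite expf_neq0.
(* [z] is the lower left corner. The threshold is divided by 4 at each step because the circulation
   is the sum of those of the four quarters. *)
pose bad n (z : R * R) := [/\ a <= z.1, z.1 + w n <= b, c <= z.2, z.2 + h n <= d &
  eta / 4 ^+ n < `|circulation z.1 (z.1 + w n) z.2 (z.2 + h n)|].
pose step n (z z' : R * R) := [/\ z.1 <= z'.1, z'.1 + w n.+1 <= z.1 + w n,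
   z.2 <= z'.2 & z'.2 + h n.+1 <= z.2 + h n].
have badS n z : bad n z -> exists z', bad n.+1 z' /\ step n z z'.
  move=> [z1 z2 z3 z4 z5].
  apply: contrapT => /forallNP good.
  have wn := w0 n.+1; have hn := h0 n.+1; have wn' := wS n; have hn' := hS n.
  have half (x x' l l' : R) : 0 <= l' -> l = l' + l' -> x' = x \/ x' = x + l' ->
      x <= x' /\ x' + l' <= x + l.
    by move=> l'0 -> [] ->; split; rewrite ?addrA ?lerDl// lerDr.
  have small z' : z'.1 = z.1 \/ z'.1 = z.1 + w n.+1 ->
      z'.2 = z.2 \/ z'.2 = z.2 + h n.+1 ->
      `|circulation z'.1 (z'.1 + w n.+1) z'.2 (z'.2 + h n.+1)| <= eta / 4 ^+ n.+1.
    move=> /(half _ _ _ _ wn wn')[A B] /(half _ _ _ _ hn hn')[C D].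
    rewrite leNgt; apply/negP => lt; apply: (good z'); split; split => //.
    - exact: le_trans A.
    - exact: le_trans B z2.
    - exact: le_trans C.
    - exact: le_trans D z4.
  have [xm mx] : z.1 <= z.1 + w n.+1 /\ z.1 + w n.+1 <= z.1 + w n.
    by rewrite wn' addrA !lerDl.
  have [yn ny] : z.2 <= z.2 + h n.+1 /\ z.2 + h n.+1 <= z.2 + h n.
    by rewrite hn' addrA !lerDl.
  have := @circulation_split z.1 (z.1 + w n) z.2 (z.2 + h n) (z.1 + w n.+1) (z.2 + h n.+1).
  have E1 : z.1 + w n = z.1 + w n.+1 + w n.+1 by rewrite wn' addrA.
  have E2 : z.2 + h n = z.2 + h n.+1 + h n.+1 by rewrite hn' addrA.
  move=> D; have {}D := D z1 xm mx z2 z3 yn ny z4.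
  rewrite D E1 E2 in z5.
  have S1 := small (z.1, z.2) (or_introl erefl) (or_introl erefl).
  have S2 := small (z.1 + w n.+1, z.2) (or_intror erefl) (or_introl erefl).
  have S3 := small (z.1, z.2 + h n.+1) (or_introl erefl) (or_intror erefl).
  have S4 := small (z.1 + w n.+1, z.2 + h n.+1) (or_intror erefl) (or_intror erefl).
  rewrite /= in S1 S2 S3 S4.
  have E : eta / 4 ^+ n = 4 * (eta / 4 ^+ n.+1).
    by rewrite exprS; field; rewrite expf_neq0.
  rewrite E in z5.
  have := lt_le_trans z5 (le_trans (ler_normD _ _) (lerD (ler_normD _ _) (ler_normD _ _))).
  move=> /lt_le_trans/(_ (lerD (lerD S1 S2) (lerD S3 S4))).
  by rewrite (_ : 4 * _ = eta / 4 ^+ n.+1 + eta / 4 ^+ n.+1 +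
    (eta / 4 ^+ n.+1 + eta / 4 ^+ n.+1)) ?ltxx//; ring.
have bad00 : bad 0%N (a, c).
  have -> : bad 0%N (a, c) = [/\ a <= a, a + w 0%N <= b, c <= c, c + h 0%N <= d &
    eta / 4 ^+ 0 < `|circulation a (a + w 0%N) c (c + h 0%N)|] by [].
  have -> : a + w 0%N = b by rewrite /w expr0; lra.
  have -> : c + h 0%N = d by rewrite /h expr0; lra.
  by split => //; rewrite expr0 divr1.
pose nxt n z := xget z [set z' | bad n.+1 z' /\ step n z z'].
pose u := fix u n := if n is m.+1 then nxt m (u m) else (a, c).
have nxtP n z : bad n z -> bad n.+1 (nxt n z) /\ step n z (nxt n z).
  by move=> /badS[z' Hz']; rewrite /nxt; case: xgetP => // /(_ z').
have ubad n : bad n (u n) by elim: n => [//|n /nxtP[]].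
have ustep n : step n (u n) (u n.+1) by have [] := nxtP n _ (ubad n).
have nest m n : (m <= n)%N -> [/\ (u m).1 <= (u n).1, (u n).1 + w n <= (u m).1 + w m,
    (u m).2 <= (u n).2 & (u n).2 + h n <= (u m).2 + h m].
  elim: n => [|n IH]; first by rewrite leqn0 => /eqP ->.
  rewrite leq_eqVlt => /predU1P[-> //|]; rewrite ltnS => /IH[A B C D].
  by have [A' B' C' D'] := ustep n; split; lra.
have cross m n : (u m).1 <= (u n).1 + w n /\ (u m).2 <= (u n).2 + h n.
  have := w0 m; have := h0 m; have := w0 n; have := h0 n.
  by have [/nest[]|/ltnW/nest[]] := leqP m n; split; lra.
(* The lower left corners increase and stay below every upper right corner, so their suprema give a
   point common to all the rectangles. *)
pose X := sup (range (fun n => (u n).1)); pose Y := sup (range (fun n => (u n).2)).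
have XP n : (u n).1 <= X <= (u n).1 + w n.
  apply/andP; split.
    apply: sup_ubound; last by exists n.
    by exists ((u 0%N).1 + w 0%N) => _ [m _ <-]; have [] := cross m 0%N.
  apply: sup_le_ub; first by exists (u 0%N).1, 0%N.
  by move=> _ [m _ <-]; have [] := cross m n.
have YP n : (u n).2 <= Y <= (u n).2 + h n.
  apply/andP; split.
    apply: sup_ubound; last by exists n.
    by exists ((u 0%N).2 + h 0%N) => _ [m _ <-]; have [] := cross m 0%N.
  apply: sup_le_ub; first by exists (u 0%N).2, 0%N.
  by move=> _ [m _ <-]; have [] := cross m n.
have Xin : a <= X <= b.
  by have [A B _ _ _] := ubad 0%N; have /andP[] := XP 0%N; move=> *; apply/andP; split; lra.
have Yin : c <= Y <= d.
  by have [_ _ A B _] := ubad 0%N; have /andP[] := YP 0%N; move=> *; apply/andP; split; lra.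
have [p [q [r Hloc]]] := closedPQ Xin Yin.
(* Chosen so that the local bound [2 * e * (w n + h n) ^+ 2] is at most [eta / 4 ^+ n]; the summand
   1 keeps the denominator positive for a degenerate rectangle. *)
pose e := eta / (2 * (b - a + (d - c)) ^+ 2 + 1).
have den0 : 0 < 2 * (b - a + (d - c)) ^+ 2 + 1 by rewrite ltr_wpDl// mulr_ge0// sqr_ge0.
have e0 : 0 < e by rewrite divr_gt0.
have [k k0 {}Hloc] := Hloc e e0.
have [n Hn] : exists n, (b - a) + (d - c) <= k * 2 ^+ n.
  exists (Num.truncn ((b - a + (d - c)) / k)).+1.
  rewrite mulrC -ler_pdivrMr//; apply: le_trans (ltW (truncnS_gt _)) _.
  rewrite -natrX ler_nat ltnW//; exact: ltn_expl.
have p2 : 0 < 2 ^+ n :> R by rewrite exprn_gt0.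
have wk : w n <= k by rewrite /w ler_pdivrMr//; lra.
have hk : h n <= k by rewrite /h ler_pdivrMr//; lra.
have [A B C D] := ubad n; apply/negP; rewrite -leNgt.
apply: (le_trans (circulation_local (w0 n) (h0 n) wk hk (ltW e0) Hloc A B C D (XP n) (YP n))).
have -> : (4 : R) ^+ n = (2 ^+ n) ^+ 2 by rewrite -exprM mulnC exprM; congr (_ ^+ _); ring.
have -> : w n + h n = (b - a + (d - c)) / 2 ^+ n by rewrite /w /h; ring.
rewrite expr_div_n mulrA ler_pM2r ?invr_gt0 ?exprn_gt0//.
rewrite /e -[leRHS]mulr1 [2 * _]mulrC -!mulrA ler_pM2l//.
by rewrite mulrC ler_pdivrMr// mul1r lerDl.
Qed.

Lemma goursat_edges :
  \int[mu]_(y in `[c, d]) Q b y - \int[mu]_(y in `[c, d]) Q a y =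
  \int[mu]_(x in `[a, b]) P x d - \int[mu]_(x in `[a, b]) P x c.
Proof. by apply/eqP; rewrite -subr_eq0; apply/eqP; exact: goursat_rectangle. Qed.

End Goursat.

(** * The complex exponential and the mean value property *)

Section MeanValue.
Variable R : realType.
Notation mu := (@lebesgue_measure R).

Lemma is_derive_approx (f : R -> R) (x df : R) : is_derive x 1 f df ->
  forall e : R, 0 < e -> exists2 k : R, 0 < k &
    forall h, `|h| <= k -> `|f (x + h) - f x - df * h| <= e * `|h|.
Proof.
move=> H e e0.
have [/derivable_nbhs + fd] := (@ex_derive _ _ _ _ _ _ _ H, @derive_val _ _ _ _ _ _ _ H).
move: H => [/cvg_ex[l /= Hl] E].
have {E} E : l = df by rewrite -E; apply/esym/cvg_lim.
move=> _; move: Hl; rewrite E => /cvgrPdist_le /(_ e e0).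
rewrite near_withinE => /nbhs_ballP[d /= d0 Hd].
exists (d / 2) => [|h hd]; first by rewrite divr_gt0.
have [->|h0] := eqVneq h 0; first by rewrite mulr0 addr0 subrr subr0 normr0 mulr0.
have := Hd h; rewrite /ball /= sub0r normrN => /(_ _ h0).
have hd' : `|h| < d by lra.
move=> /(_ hd'); rewrite [h%:A]mulr1 (addrC h).
have -> : df - h^-1 * (f (x + h) - f x) = - (f (x + h) - f x - df * h) / h by field.
by rewrite normrM normrN normfV ler_pdivrMr ?normr_gt0.
Qed.

(** The exponential of [s + i t]. *)
Definition cexp (s t : R) : R[i] := Complex (expR s * cos t) (expR s * sin t).

Lemma cexpD s t s' t' : cexp (s + s') (t + t') = cexp s t * cexp s' t'.
Proof.
by apply/eqP; rewrite eq_complex /= expRD cosD sinD; apply/andP; split; apply/eqP; ring.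
Qed.

Lemma cabs_cexp s t : cabs (cexp s t) = expR s.
Proof.
rewrite /= !exprMn -mulrDr cos2Dsin2 mulr1 sqrtr_sqr ger0_norm// expR_ge0//.
Qed.

(** The exponential has derivative 1 at 0, by the derivatives of the real functions [expR], [cos]
    and [sin] there. *)
Lemma cexp_approx (e : R) : 0 < e -> exists2 k : R, 0 < k &
  forall s t, `|s| <= k -> `|t| <= k ->
    cabs (cexp s t - 1 - Complex s t) <= e * (`|s| + `|t|).
Proof.
move=> e0; have [e' [e8 e'1 e'e]] : exists e', [/\ 0 < e', e' <= 1 & e' <= e / 8].
  (* The errors collected below add up to at most [8 * e'] times the sum of the moduli of [s] and
     [t]. *)
  by exists (Num.min (e / 8) 1); split;
    rewrite ?lt_min ?ge_min ?lexx ?orbT// ltr01 andbT divr_gt0.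
have [k1 k10 E] := is_derive_approx (is_derive_expR (0 : R)) e8.
have [k2 k20 Co] := is_derive_approx (is_derive_cos (0 : R)) e8.
have [k3 k30 Si] := is_derive_approx (is_derive_sin (0 : R)) e8.
exists (Num.min e' (Num.min k1 (Num.min k2 k3))); first by rewrite !lt_min e8 k10 k20.
move=> s t; rewrite !le_min => /andP[s1 /andP[sk1 _]] /andP[t1 /andP[_ /andP[tk2 tk3]]].
have {E} := E s sk1; rewrite expR0 add0r mul1r => E.
have {Co} := Co t tk2; rewrite cos0 sin0 add0r oppr0 mul0r subr0 => Co.
have {Si} := Si t tk3; rewrite cos0 sin0 add0r mul1r subr0 => Si.
apply: le_trans (cabs_le_ReIm _) _ => /=.
have s0 := normr_ge0 s; have t0 := normr_ge0 t.
have c1 := cos_max t.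
have E1 : `|expR s - 1| <= 2 * `|s|.
  rewrite (_ : expR s - 1 = (expR s - 1 - s) + s); last by ring.
  apply: le_trans (ler_normD _ _) _; nra.
have Si1 : `|sin t| <= 2 * `|t|.
  rewrite (_ : sin t = (sin t - t) + t); last by ring.
  apply: le_trans (ler_normD _ _) _; nra.
have A : `|expR s * cos t - 1 - s| <= e' * `|s| + 3 * (e' * `|t|).
  have -> : expR s * cos t - 1 - s = (expR s - 1 - s) + (1 + (expR s - 1)) * (cos t - 1) by ring.
  apply: le_trans (ler_normD _ _) _; rewrite normrM lerD//.
  apply: ler_pM => //; apply: (le_trans (ler_normD _ _)); rewrite normr1; lra.
have B : `|expR s * sin t - 0 - t| <= 2 * `|s| * (2 * `|t|) + e' * `|t|.
  have -> : expR s * sin t - 0 - t = (expR s - 1) * sin t + (sin t - t) by ring.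
  apply: le_trans (ler_normD _ _) _; rewrite normrM lerD//.
  by apply: ler_pM.
apply: le_trans (lerD A B) _; nra.
Qed.

(** Chain rule for [F] composed with the exponential: since [cexp (x + s) (y + t)] is
    [z * cexp s t], the derivative is [l * z], with [l] the derivative of [F] at [z]. *)
Lemma cderivable_polar (F : R[i] -> R[i]) x y :
  derivable (F : R[i]^o -> R[i]^o) (cexp x y) 1 ->
  exists k : R[i], forall e : R, 0 < e -> exists2 d : R, 0 < d &
    forall s t, `|s| <= d -> `|t| <= d ->
      cabs (F (cexp (x + s) (y + t)) - F (cexp x y) - k * Complex s t)
      <= e * (`|s| + `|t|).
Proof.
move=> /derivable_cderivP[l Hl]; set z := cexp x y in Hl *.
exists (l * z) => e e0.
set K := cabs (l * z); have K0 : 0 <= K by exact: cabs_ge0.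
have Z0 : 0 < cabs z by rewrite cabs_cexp expR_gt0.
have e1 : 0 < e / (4 * cabs z) by rewrite divr_gt0// mulr_gt0.
have e2 : 0 < e / (2 * (K + 1)) by rewrite divr_gt0// mulr_gt0// ltr_wpDl.
have [d d0 {}Hl] := Hl _ e1.
have [d1 d10 C1] := cexp_approx ltr01.
have [d2 d20 C2] := cexp_approx e2.
have d4 : 0 < d / (8 * cabs z) by rewrite divr_gt0// mulr_gt0.
exists (Num.min (d / (8 * cabs z)) (Num.min d1 d2)); first by rewrite !lt_min d4 d10 d20.
move=> s t; rewrite !le_min => /andP[s1 /andP[s2 s3]] /andP[t1 /andP[t2 t3]].
have {}C1 := C1 s t s2 t2; have {}C2 := C2 s t s3 t3.
have s0 := normr_ge0 s; have t0 := normr_ge0 t.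
set h := z * (cexp s t - 1).
have hz : cabs (cexp s t - 1) <= 2 * (`|s| + `|t|).
  rewrite (_ : cexp s t - 1 = (cexp s t - 1 - Complex s t) + Complex s t); last by ring.
  apply: le_trans (cabsD _ _) _.
  have H : cabs (Complex s t) <= `|s| + `|t| by exact: cabs_le_ReIm.
  by move: C1 H; set A := cabs _; set B := cabs _ => C1 H; lra.
have hb : cabs h <= cabs z * (2 * (`|s| + `|t|)) by rewrite cabsM ler_pM2l.
have hd : cabs h < d.
  apply: le_lt_trans hb _.
  rewrite mulrC -ltr_pdivlMr//.
  have E : d / (8 * cabs z) = (d / cabs z) / 8 by field; rewrite gt_eqF.
  rewrite E in s1 t1; have : 0 < d / cabs z by rewrite divr_gt0.
  move=> ?; lra.
have {}Hl := Hl h hd.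
have -> : F (cexp (x + s) (y + t)) - F z - l * z * Complex s t =
   (F (z + h) - F z - l * h) + l * z * (cexp s t - 1 - Complex s t).
  rewrite cexpD -/z (_ : z + h = z * cexp s t); first by rewrite /h; ring.
  by rewrite /h; ring.
apply: le_trans (cabsD _ _) _.
have A : cabs (F (z + h) - F z - l * h) <= e / 2 * (`|s| + `|t|).
  apply: le_trans Hl _.
  apply: (@le_trans _ _ (e / (4 * cabs z) * (cabs z * (2 * (`|s| + `|t|))))).
    by rewrite ler_wpM2l// ltW.
  by rewrite le_eqVlt; apply/orP; left; apply/eqP; field; rewrite gt_eqF.
have B : cabs (l * z * (cexp s t - 1 - Complex s t)) <= e / 2 * (`|s| + `|t|).
  rewrite cabsM -/K.
  apply: (@le_trans _ _ ((K + 1) * (e / (2 * (K + 1)) * (`|s| + `|t|)))).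
    by apply: ler_pM => //; [exact: cabs_ge0|rewrite lerDl].
  by rewrite le_eqVlt; apply/orP; left; apply/eqP; field; rewrite gt_eqF// ltr_wpDl.
rewrite [e in leRHS](splitr e) mulrDl; exact: lerD.
Qed.

(* Goursat's theorem in the coordinates [z = exp (x + i y)], for [Im F dx + Re F dy] on the
   rectangle [x, 0] * [0, 2 pi], whose horizontal sides cancel by periodicity. *)
Theorem mean_value (F : R[i] -> R[i]) :
  (forall z, cabs z <= 1 -> derivable (F : R[i]^o -> R[i]^o) z 1) ->
  \int[mu]_(t in `[0, 2 * pi]) complex.Re (F (cis t)) = 2 * pi * complex.Re (F 0).
Proof.
move=> dF.
pose P x y := complex.Im (F (cexp x y)); pose Q x y := complex.Re (F (cexp x y)).
have pi2 : 0 <= 2 * pi :> R by rewrite mulr_ge0// pi_ge0.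
have closedPQ x y : x <= 0 -> exists p q r : R, forall e : R, 0 < e -> exists2 k : R, 0 < k &
    forall s t, `|s| <= k -> `|t| <= k ->
      `|P (x + s) (y + t) - P x y - (p * s + q * t)| <= e * (`|s| + `|t|) /\
      `|Q (x + s) (y + t) - Q x y - (q * s + r * t)| <= e * (`|s| + `|t|).
  move=> x0; have : derivable (F : R[i]^o -> R[i]^o) (cexp x y) 1.
    by apply: dF; rewrite cabs_cexp -expR0 ler_expR.
  (* The Cauchy-Riemann equations: [k1 + i k2] times [s + i t] has imaginary part [k2 * s + k1 * t]
     and real part [k1 * s - k2 * t], so the form is closed with common coefficient [k1]. *)
  move=> /cderivable_polar[[k1 k2] H]; exists k2, k1, (- k2) => e e0.
  have [d d0 {}H] := H e e0; exists d => // s t sd td.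
  have {H} := H s t sd td; rewrite /P /Q.
  set w1 := F (cexp (x + s) (y + t)); set w0 := F (cexp x y) => H.
  split; apply: le_trans H.
    rewrite (_ : _ - _ = complex.Im (w1 - w0 - Complex k1 k2 * Complex s t)) ?cabs_Im//.
    by case: (w1) (w0) => [a b] [a' b'] /=; ring.
  rewrite (_ : _ - _ = complex.Re (w1 - w0 - Complex k1 k2 * Complex s t)) ?cabs_Re//.
  by case: (w1) (w0) => [a b] [a' b'] /=; ring.
(* The vertical sides of the rectangle are the circles of radii [expR x] and 1, so the integral does
   not depend on the radius. *)
have cst x : x <= 0 -> \int[mu]_(t in `[0, 2 * pi]) complex.Re (F (cis t)) =
    \int[mu]_(t in `[0, 2 * pi]) Q x t.
  move=> x0; have cl x' y' : x <= x' <= 0 -> 0 <= y' <= 2 * pi -> _ :=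
    fun h _ => closedPQ x' y' (proj2 (andP h)).
  have /eqP := @goursat_edges R P Q x 0 0 (2 * pi) x0 pi2 cl.
  have -> : \int[mu]_(s in `[x, 0]) P s (2 * pi) = \int[mu]_(s in `[x, 0]) P s 0.
    by apply: eq_Rintegral => s _; rewrite /P /cexp mulr_natl cos2pi sin2pi cos0 sin0.
  rewrite subrr subr_eq0 => /eqP <-.
  by apply: eq_Rintegral => t _; rewrite /Q /cexp expR0 !mul1r.
apply/eqP; rewrite -subr_eq0 -normr_le0; apply/ler_addgt0Pl.
suff H (e : R) : 0 < e -> `|\int[mu]_(t in `[0, 2 * pi]) complex.Re (F (cis t)) -
    2 * pi * complex.Re (F 0)| <= e by move=> e e0; rewrite addr0 H.
move=> e0; have piN : 0 < 2 * pi + 1 :> R by rewrite ltr_wpDl.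
have ep : 0 < e / (2 * pi + 1) by rewrite divr_gt0.
have /cderivable_continuous : derivable (F : R[i]^o -> R[i]^o) 0 1.
  by apply: dF; rewrite cabs0.
have ep' : 0 < (e / (2 * pi + 1))%:C%C by rewrite ltcR.
move=> /cvgrPdist_le /(_ _ ep') /nbhs_ballP[_ /= /gt0_complex[d d0 ->] Hd].
(* The circle of radius [expR x] lies where [F] is close to [F 0]. *)
pose x := Num.min 0 (ln (d / 2)).
have x0 : x <= 0 by rewrite /x ge_min lexx.
have xd : expR x < d.
  apply: (@le_lt_trans _ _ (d / 2)); last by lra.
  by rewrite -[leRHS]lnK ?posrE ?divr_gt0// ler_expR /x ge_min lexx orbT.
have := @Rintegral_close R (Q x) 0 (2 * pi) (complex.Re (F 0)) (e / (2 * pi + 1)) pi2.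
rewrite subr0 (cst x x0) [2 * pi * _]mulrC => H.
apply: le_trans (H _ _) _; last first.
- by rewrite mulrAC ler_pdivrMr// ler_wpM2l ?ltW// ltrDl.
- move=> t _; rewrite /Q -raddfB; apply: le_trans (cabs_Re _) _.
  rewrite -lecR -normr_cabs distrC; apply: Hd.
  by rewrite /ball /= sub0r normrN normr_cabs ltcR cabs_cexp.
- apply: continuous_itv_integrable => t _.
  apply: (@closed_form_continuousQ R P Q x x t t); rewrite ?lexx//.
  by move=> x' y' /andP[_ hx] _; apply: closedPQ; exact: le_trans hx x0.
Qed.

End MeanValue.

(** * The weak type inequality *)

Section CDerivable.
Variable R : realType.
Implicit Types (F G : R[i] -> R[i]) (z a : R[i]).

Lemma cderivable_cst a z : derivable ((fun=> a) : R[i]^o -> R[i]^o) z 1.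
Proof. exact: derivable_cst. Qed.

Lemma cderivableD F G z :
  derivable (F : R[i]^o -> R[i]^o) z 1 -> derivable (G : R[i]^o -> R[i]^o) z 1 ->
  derivable ((fun w => F w + G w) : R[i]^o -> R[i]^o) z 1.
Proof. exact: derivableD. Qed.

Lemma cderivableM F G z :
  derivable (F : R[i]^o -> R[i]^o) z 1 -> derivable (G : R[i]^o -> R[i]^o) z 1 ->
  derivable ((fun w => F w * G w) : R[i]^o -> R[i]^o) z 1.
Proof. exact: derivableM. Qed.

Lemma cderivableV F z : F z != 0 ->
  derivable (F : R[i]^o -> R[i]^o) z 1 ->
  derivable ((fun w => (F w)^-1) : R[i]^o -> R[i]^o) z 1.
Proof. exact: derivableV. Qed.

Lemma cderivable_scale F a z :
  derivable (F : R[i]^o -> R[i]^o) (a * z) 1 ->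
  derivable ((fun w => F (a * w)) : R[i]^o -> R[i]^o) z 1.
Proof.
move=> /derivable_cderivP[l Hl]; apply/derivable_cderivP.
exists (l * a) => e e0; have a0 := cabs_ge0 a.
(* The summand 1 covers the case [a = 0]. *)
have a1 : 0 < cabs a + 1 by rewrite ltr_wpDl.
have e1 : 0 < e / (cabs a + 1) by rewrite divr_gt0.
have [d d0 {}Hl] := Hl _ e1; exists (d / (cabs a + 1)); first by rewrite divr_gt0.
move=> h; rewrite ltr_pdivlMr// => hd; have h0 := cabs_ge0 h.
have hd' : cabs (a * h) < d by rewrite cabsM; apply: le_lt_trans hd; nra.
rewrite mulrDr -mulrA; apply: le_trans (Hl _ hd') _.
rewrite cabsM mulrA ler_wpM2r// mulrAC ler_pdivrMr// ler_wpM2l ?ltW//; lra.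
Qed.

Lemma cderivable_sum (I : Type) (r : seq I) (F : I -> R[i] -> R[i]) z :
  (forall i, derivable (F i : R[i]^o -> R[i]^o) z 1) ->
  derivable ((fun w => \sum_(i <- r) F i w) : R[i]^o -> R[i]^o) z 1.
Proof.
move=> dF; elim: r => [|i r IH].
  by under eq_fun do rewrite big_nil; exact: cderivable_cst.
have -> : (fun w => \sum_(j <- i :: r) F j w) = (fun w => F i w + \sum_(j <- r) F j w).
  by apply/funext => w; rewrite big_cons.
by apply: cderivableD; [exact: dF|exact: IH].
Qed.

Lemma continuous_Re_cis F t :
  {for cis t, continuous (F : R[i]^o -> R[i]^o)} ->
  {for t, continuous (fun t => complex.Re (F (cis t)))}.
Proof.
by move=> Fc; have /cvg_complexP[] := cvg_comp _ _ (@continuous_cis R t) Fc.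
Qed.

Lemma continuous_Im_cis F t :
  {for cis t, continuous (F : R[i]^o -> R[i]^o)} ->
  {for t, continuous (fun t => complex.Im (F (cis t)))}.
Proof.
by move=> Fc; have /cvg_complexP[] := cvg_comp _ _ (@continuous_cis R t) Fc.
Qed.

Lemma continuous_cabs_cis F t :
  {for cis t, continuous (F : R[i]^o -> R[i]^o)} ->
  {for t, continuous (fun t => cabs (F (cis t)))}.
Proof.
by move=> Fc; exact: cvg_cabs (cvg_comp _ _ (@continuous_cis R t) Fc).
Qed.

End CDerivable.

Section WeakType.
Variable R : realType.
Notation mu := (@lebesgue_measure R).

Lemma chebyshev_superlevel (A : set R) (f : R -> R) (c : R) :
  measurable A -> measurable_fun A f -> 0 < c -> (forall x, A x -> 0 <= f x) ->
  (c%:E * mu (A `&` [set x | (c <= f x)%R]) <= \int[mu]_(x in A) (f x)%:E)%E.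
Proof.
move=> mA mf c0 f0.
have := @le_integral_comp_abse _ _ _ mu A mA (fun x => (f x)%:E) c id (@measurable_id _ _ _)
  (fun r h => h) (fun x y _ _ h => h).
have mf' : measurable_fun A (fun x => (f x)%:E) by exact/measurable_EFinP.
move=> /(_ mf' c0).
rewrite [X in (_ <= X)%E](_ : _ = \int[mu]_(x in A) (f x)%:E)%E; last first.
  by apply: eq_integral => x; rewrite inE => Ax /=; rewrite ger0_norm// f0.
apply: le_trans; rewrite le_eqVlt; apply/orP; left; apply/eqP; congr (_ * mu _)%E.
by apply/seteqP; split => x [Ax /= h]; split => //=; move: h; rewrite lee_fin ger0_norm// f0.
Qed.

Lemma measurable_superlevel (A : set R) (f : R -> R) (c : R) :
  measurable A -> measurable_fun A f -> measurable (A `&` [set x | c <= f x]).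
Proof.
move=> mA mf; have := mf mA `[c, +oo[%classic (measurable_itv _).
by congr measurable; apply/seteqP; split => x [Ax /=]; rewrite in_itv /= andbT.
Qed.

Lemma cabs_sqr (z : R[i]) : cabs z ^+ 2 = complex.Re z ^+ 2 + complex.Im z ^+ 2.
Proof. by case: z => a b /=; rewrite sqr_sqrtr// addr_ge0// sqr_ge0. Qed.

Lemma Re_neq0 (z : R[i]) : 0 < complex.Re z -> z != 0.
Proof. by move=> z0; apply: contraTneq z0 => ->; rewrite ltxx. Qed.

(* [K = G / (G + s)] satisfies [Re K >= 0], and [Re K >= 1/4] where [|G| >= s], while the mean
   of [Re K] is [Re (K 0) <= g0 / s]. *)
Theorem weak_type (G : R[i] -> R[i]) (g0 s : R) :
  (forall z, cabs z <= 1 -> derivable (G : R[i]^o -> R[i]^o) z 1) ->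
  (forall z, cabs z <= 1 -> 0 <= complex.Re (G z)) ->
  G 0 = Complex g0 0 -> 0 < s ->
  (mu (`[0%R, (2 * pi)%R] `&` [set t | (s <= cabs (G (cis t)))%R]) <= (8 * pi * g0 / s)%:E)%E.
Proof.
move=> dG ReG G0 s0.
have g0ge : 0 <= g0 by have := ReG 0; rewrite cabs0 ler01 G0; exact.
pose K z := G z / (G z + Complex s 0).
have den z : cabs z <= 1 -> G z + Complex s 0 != 0.
  move=> /ReG h; apply: Re_neq0; rewrite raddfD /=; exact: ltr_wpDl.
have dK z : cabs z <= 1 -> derivable (K : R[i]^o -> R[i]^o) z 1.
  move=> z1; apply: cderivableM; first exact: dG.
  apply: cderivableV; first exact: den.
  by apply: cderivableD; [exact: dG|exact: cderivable_cst].
have ReK z : cabs z <= 1 -> 0 <= complex.Re (K z) /\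
    (s <= cabs (G z) -> 4^-1 <= complex.Re (K z)).
  move=> /ReG; rewrite /K; have := cabs_sqr (G z).
  case: (G z) => a b /=; set N := Num.sqrt _ => HN a0; rewrite addr0.
  have E : a * ((a + s) / ((a + s) ^+ 2 + b ^+ 2)) - b * - (b / ((a + s) ^+ 2 + b ^+ 2)) =
     (a * (a + s) + b ^+ 2) / ((a + s) ^+ 2 + b ^+ 2) by ring.
  have D0 : 0 < (a + s) ^+ 2 + b ^+ 2.
    by rewrite ltr_wpDr ?sqr_ge0// exprn_gt0// ltr_wpDl.
  rewrite E; split.
    by rewrite divr_ge0// ?(ltW D0)// addr_ge0 ?sqr_ge0// mulr_ge0// addr_ge0// ltW.
  move=> sN; rewrite ler_pdivlMr//.
  have : s ^+ 2 <= N ^+ 2 by rewrite lerXn2r ?nnegrE ?sqrtr_ge0// ltW.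
  (* The inequality to prove reduces to [s ^+ 2 <= 3 * (a ^+ 2 + b ^+ 2) + 2 * a * s]. *)
  rewrite HN; nra.
have mv := mean_value dK.
have cK t : {for t, continuous (fun t => complex.Re (K (cis t)))}.
  by apply: continuous_Re_cis; apply: cderivable_continuous; apply: dK; rewrite cabs_cis.
have iK : mu.-integrable `[0, 2 * pi] (EFin \o (fun t => complex.Re (K (cis t)))).
  by apply: continuous_itv_integrable => t _; exact: cK.
have cis1 t : cabs (cis t : R[i]) <= 1 by rewrite cabs_cis.
(* Chebyshev's inequality at level 1/4, applied to a function of integral [2 * pi * Re (K 0)], is
   the origin of the constant [8 * pi]. *)
have := @chebyshev_superlevel `[0, 2 * pi] (fun t => complex.Re (K (cis t))) 4^-1
  (measurable_itv _) _ _ _.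
move=> H; have {}H := H ((measurable_EFinP _ _).1 (measurable_int _ iK)) _ (fun x _ => (ReK _ (cis1 x)).1).
have {}H := H ltac:(by rewrite invr_gt0).
have Efin : (\int[mu]_(x in `[0%R, (2 * pi)%R]) (complex.Re (K (cis x)))%:E)%E =
    (2 * pi * complex.Re (K 0))%:E.
  by rewrite -mv /Rintegral fineK//; exact: integrable_fin_num iK.
rewrite Efin in H.
have mG : measurable_fun setT (fun t => cabs (G (cis t))).
  apply: continuous_measurable_fun => t; apply: continuous_cabs_cis.
  by apply: cderivable_continuous; exact: dG.
have mK : measurable_fun setT (fun t => complex.Re (K (cis t))).
  by apply: continuous_measurable_fun => t; exact: cK.
have sub : (mu (`[0%R, (2 * pi)%R] `&` [set t | (s <= cabs (G (cis t)))%R]) <=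
   mu (`[0%R, (2 * pi)%R] `&` [set t | (4^-1 <= complex.Re (K (cis t)))%R]))%E.
  apply: le_measure; rewrite ?inE.
  - by apply: measurable_superlevel => //; exact: measurable_funTS.
  - by apply: measurable_superlevel => //; exact: measurable_funTS.
  - by move=> t [At /= st]; split => //; exact: (ReK _ (cis1 t)).2.
move: H; rewrite lee_pdivrMl// => /(le_trans sub) /le_trans; apply.
rewrite -EFinM lee_fin /K G0.
have -> : complex.Re (Complex g0 0 / (Complex g0 0 + Complex s 0)) = g0 / (g0 + s).
  have gs : g0 + s != 0 by rewrite gt_eqF// ltr_wpDl.
  by rewrite /= addr0 mul0r subr0 expr0n addr0; field.
rewrite (_ : 4 * (2 * pi * (g0 / (g0 + s))) = 8 * pi * (g0 / (g0 + s))); last by ring.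
rewrite -[leRHS]mulrA ler_wpM2l//; first by rewrite mulr_ge0// pi_ge0.
by rewrite ler_wpM2l// lef_pV2 ?posrE ?ltr_wpDl// lerDr.
Qed.

End WeakType.

(** * Discrete Herglotz integrals *)

Section Herglotz.
Variable R : realType.
Notation mu := (@lebesgue_measure R).

Lemma riemann_sum (v : R -> R) (T e d : R) (N : nat) :
  0 <= T -> continuous v -> (0 < N)%N -> T / N%:R <= d ->
  (forall s t, `|s - t| <= d -> `|v s - v t| <= e) ->
  `|\int[mu]_(t in `[0, T]) v t - T / N%:R * \sum_(j < N) v (T / N%:R * j%:R)| <= T * e.
Proof.
move=> T0 vc N0 Nd ve; set k := T / N%:R.
have k0 : 0 <= k by rewrite divr_ge0.
have vi a b : mu.-integrable `[a, b] (EFin \o v) by apply: continuous_itv_integrable => ? _; exact: vc.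
suff H n : `|\int[mu]_(t in `[0, k * n%:R]) v t - k * \sum_(j < n) v (k * j%:R)| <= k * n%:R * e.
  by have := H N; rewrite /k divfK// pnatr_eq0 -lt0n.
elim: n => [|n IH].
  by rewrite mulr0 big_ord0 mulr0 mul0r subr0 set_itv1 Rintegral_set1 normr0.
have knS : k * n.+1%:R = k * n%:R + k by rewrite -natr1 mulrDr mulr1.
rewrite (@Rintegral_split _ _ _ (k * n%:R)) ?mulr_ge0//; last by rewrite knS lerDl.
rewrite big_ord_recr /= mulrDr.
have := @Rintegral_close R v (k * n%:R) (k * n.+1%:R) (v (k * n%:R)) e.
rewrite knS lerDl addrAC subrr add0r => /(_ k0 (vi _ _)) H.
have {H} : `|\int[mu]_(x in `[(k * n%:R), (k * n%:R + k)]) v x - v (k * n%:R) * k| <= e * k.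
  apply: H => x /andP[x1 x2]; apply: ve; rewrite ger0_norm ?subr_ge0//.
  by apply: le_trans Nd; rewrite -/k; lra.
move: IH; rewrite !ler_norml => /andP[A1 A2] /andP[B1 B2]; apply/andP; split; lra.
Qed.

Lemma cisD (s t : R) : cis (s + t) = cis s * cis t.
Proof.
apply/eqP; rewrite eq_complex /= cosD sinD; apply/andP; split; apply/eqP; ring.
Qed.

(** The cosine and the sine are each 1-Lipschitz by the mean value theorem; adding the two bounds
    gives the constant 2. *)
Lemma cis_lipschitz (s t : R) : cabs (cis s - cis t) <= 2 * `|s - t|.
Proof.
wlog st : s t / t <= s.
  move=> H; have [/H//|/ltW/H] := leP t s.
  by rewrite -cabsN opprB distrC.
move: st; rewrite le_eqVlt => /predU1P[->|st]; first by rewrite subrr cabs0 subrr normr0 mulr0.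
apply: le_trans (cabs_le_ReIm _) _; rewrite !raddfB /= (_ : 2 = 1 + 1)// mulrDl mul1r lerD//.
  have [|x _ ->] := @MVT R cos (fun x => - sin x) t s st.
    by apply: continuous_subspaceT; exact: continuous_cos.
  by rewrite normrM normrN -[leRHS]mul1r ler_wpM2r// ler_norml sin_geN1 sin_le1.
have [|x _ ->] := @MVT R sin cos t s st.
  by apply: continuous_subspaceT; exact: continuous_sin.
by rewrite normrM -[leRHS]mul1r ler_wpM2r// ler_norml cos_geN1 cos_le1.
Qed.

(** The Cayley map of the disk onto the right half-plane. It is the Herglotz kernel, and its real
    part at [rho * cis t] is the Poisson kernel. *)
Definition cayley (w : R[i]) : R[i] := (1 + w) / (1 - w).

Lemma cayley0 : cayley 0 = 1.
Proof. by rewrite /cayley addr0 subr0 divr1. Qed.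

Lemma cabs_lt1_neq1 (w : R[i]) : cabs w < 1 -> 1 - w != 0.
Proof.
move=> w1; apply/eqP => /subr0_eq e; by move: w1; rewrite -e cabs1 ltxx.
Qed.

Lemma cderivable_cayley w : cabs w < 1 -> derivable (cayley : R[i]^o -> R[i]^o) w 1.
Proof.
move=> w1; apply: cderivableM.
  by apply: cderivableD; [exact: cderivable_cst|exact: derivable_id].
apply: cderivableV; first exact: cabs_lt1_neq1.
by apply: derivableB; [exact: cderivable_cst|exact: derivable_id].
Qed.

Lemma Re_cayley (w : R[i]) :
  complex.Re (cayley w) = (1 - cabs w ^+ 2) / cabs (1 - w) ^+ 2.
Proof.
rewrite !cabs_sqr /cayley; case: w => a b /=; rewrite !add0r.
by set D := (_ ^+ 2 + _ ^+ 2)^-1; ring.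
Qed.

Lemma Re_cayley_ge0 (w : R[i]) : cabs w < 1 -> 0 <= complex.Re (cayley w).
Proof.
move=> w1; rewrite Re_cayley divr_ge0// ?exprn_ge0 ?cabs_ge0// subr_ge0.
by rewrite expr_le1 ?cabs_ge0// ltW.
Qed.

Lemma cabs_conj (a b : R) : cabs (Complex a (- b)) = cabs (Complex a b).
Proof. by rewrite /= sqrrN. Qed.

Lemma Re_cayley_conj (a b : R) :
  complex.Re (cayley (Complex a (- b))) = complex.Re (cayley (Complex a b)).
Proof.
rewrite !Re_cayley cabs_conj; congr (_ / _ ^+ 2).
have -> : 1 - Complex a (- b) = Complex (1 - a) (- (- b)).
  by apply/eqP; rewrite eq_complex /= sub0r !eqxx.
rewrite cabs_conj; congr cabs.
by apply/eqP; rewrite eq_complex /= sub0r !eqxx.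
Qed.

Lemma cisN_Re_cayley (rho t : R) :
  complex.Re (cayley (Complex rho 0 * cis (- t))) =
  complex.Re (cayley (Complex rho 0 * cis t)).
Proof.
have -> : Complex rho 0 * cis (- t) = Complex (rho * cos t) (- (rho * sin t)).
  apply/eqP; rewrite eq_complex /= cosN sinN; apply/andP; split; apply/eqP; ring.
rewrite Re_cayley_conj; congr (complex.Re (cayley _)).
apply/eqP; rewrite eq_complex /=; apply/andP; split; apply/eqP; ring.
Qed.

(** * The Poisson kernel as an approximate identity *)

Section Kernel.
Variable rho : R.
Hypothesis rho_ge0 : 0 <= rho.
Hypothesis rho_lt1 : rho < 1.
Let kernel (z : R[i]) := cayley (Complex rho 0 * z).

Lemma cabs_scale_lt1 z : cabs z <= 1 -> cabs (Complex rho 0 * z) < 1.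
Proof.
move=> z1; rewrite cabsM cabs_real ger0_norm//; apply: le_lt_trans rho_lt1.
by rewrite ler_piMr.
Qed.

Lemma cderivable_kernel z : cabs z <= 1 -> derivable (kernel : R[i]^o -> R[i]^o) z 1.
Proof.
by move=> z1; apply: cderivable_scale; apply: cderivable_cayley; exact: cabs_scale_lt1.
Qed.

Lemma Re_kernel_continuous z : cabs z <= 1 ->
  {for z, continuous (fun z : R[i]^o => complex.Re (kernel z))}.
Proof.
move=> /cderivable_kernel/cderivable_continuous kc.
by have /cvg_complexP[] := kc.
Qed.

(** The Poisson kernel is even, so [t - s] may be replaced by [s - t]; the integrand is then the
    real part of a function analytic in [cis s], with value 1 at 0. *)
Lemma kernel_total (t : R) :
  \int[mu]_(s in `[0, 2 * pi]) complex.Re (kernel (cis (t - s))) = 2 * pi.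
Proof.
pose F z := kernel (cis (- t) * z).
have dF z : cabs z <= 1 -> derivable (F : R[i]^o -> R[i]^o) z 1.
  by move=> z1; apply: cderivable_scale; apply: cderivable_kernel; rewrite cabsM cabs_cis mul1r.
have := mean_value dF.
have -> : complex.Re (F 0) = 1.
  by rewrite /F /kernel !mulr0 cayley0.
rewrite mulr1 => H; rewrite -[RHS]H; apply: eq_Rintegral => s _.
by rewrite /F -cisD /kernel -cisN_Re_cayley; congr (complex.Re (cayley (_ * cis _))); ring.
Qed.

(** At distance [d] from 1 the denominator of the Poisson kernel is at least [(d / 2) ^+ 2], because
    [rho * z] is within [1 - rho] of [z], while the numerator is at most [2 * (1 - rho)]. *)
Lemma kernel_far (z : R[i]) (d : R) : cabs z = 1 -> 0 < d -> 1 - rho <= d / 2 ->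
  d <= cabs (1 - z) -> complex.Re (kernel z) <= 8 * (1 - rho) / d ^+ 2.
Proof.
move=> z1 d0 rd zd; rewrite /kernel Re_cayley cabsM cabs_real z1 mulr1 (ger0_norm rho_ge0).
have far : d / 2 <= cabs (1 - Complex rho 0 * z).
  have H : cabs (1 - z) <= cabs (1 - Complex rho 0 * z) + (1 - rho).
    have -> : 1 - z = (1 - Complex rho 0 * z) + Complex (rho - 1) 0 * z.
      have -> : Complex (rho - 1) 0 = Complex rho 0 - 1.
        by apply/eqP; rewrite eq_complex /= subrr !eqxx.
      by ring.
    apply: le_trans (cabsD _ _) _; rewrite lerD2l cabsM z1 mulr1 cabs_real.
    by rewrite ler0_norm ?opprB// subr_le0 ltW.
  lra.
have X0 : 0 < cabs (1 - Complex rho 0 * z) by apply: lt_le_trans far; rewrite divr_gt0.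
set X := cabs _ in far X0 *.
rewrite ler_pdivrMr ?exprn_gt0// mulrAC ler_pdivlMr ?exprn_gt0//.
have : (d / 2) ^+ 2 <= X ^+ 2 by rewrite lerXn2r ?nnegrE// ltW// divr_gt0.
rewrite expr_div_n => h; have d2 : 0 <= d ^+ 2 by rewrite sqr_ge0.
have r1 : 0 <= 1 - rho by rewrite subr_ge0 ltW.
rewrite (_ : 1 - rho ^+ 2 = (1 - rho) * (1 + rho)); last by ring.
rewrite [8 * _]mulrC -!mulrA ler_wpM2l//.
have : (1 + rho) * d ^+ 2 <= 2 * d ^+ 2 by rewrite ler_wpM2r//; have := rho_lt1; lra.
lra.
Qed.

End Kernel.

Lemma ReMr (a : R) (w : R[i]) : complex.Re (Complex a 0 * w) = a * complex.Re w.
Proof. by case: w => x y /=; rewrite mul0r subr0. Qed.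

(* [G] is a Riemann sum for the Herglotz integral of [U] with the poles of its kernel pushed
   out to modulus [1 / rho], plus a small constant; so [G] is a rational function without
   poles in the closed disk. *)
Theorem herglotz (U : R[i]^o -> R) (e : R) :
  (forall z, cabs z <= 1 -> {for z, continuous U}) ->
  (forall t, 0 <= U (cis t)) -> 0 < e ->
  exists (G : R[i] -> R[i]) (g0 : R),
    [/\ forall z, cabs z <= 1 -> derivable (G : R[i]^o -> R[i]^o) z 1,
        forall z, cabs z <= 1 -> 0 <= complex.Re (G z),
        G 0 = Complex g0 0,
        forall t, U (cis t) <= complex.Re (G (cis t)) &
        2 * pi * g0 <= \int[mu]_(t in `[0, 2 * pi]) U (cis t) + e].
Proof.
move=> Uc U0 e0.
have pi0 : 0 < pi :> R := pi_gt0 R.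
have pi2 : 0 < 2 * pi :> R by rewrite mulr_gt0.
(* The constant [3 * e'] in [G] and the error [e'] of the Riemann sum of [U], integrated over the
   circle, add up to [8 * pi * e']. *)
pose e' := e / (8 * pi).
have e'0 : 0 < e' by rewrite divr_gt0// mulr_gt0.
have [B [B0 UB]] : exists B : R, 0 < B /\ forall t, U (cis t) <= B.
  have [|M HM] := @closed_disk_bounded R (fun z => Complex (U z) 0).
    move=> z /Uc cz; apply: (@cvg_complexP _ _ (nbhs (z : R[i]^o)) _ _ _).2.
    by split => /=; [exact: cz|exact: (@cvg_cst _ (0 : R))].
  exists (M + 1); have HM' t : U (cis t) <= M.
    by have := HM (cis t); rewrite cabs_cis cabs_real => /(_ (lexx _)) /(le_trans (ler_norm _)).
  split => [|t]; last by rewrite (le_trans (HM' t))// lerDl.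
  by rewrite ltr_wpDl// (le_trans (U0 0)).
have [d d0 Ud] := closed_disk_unif_continuous Uc e'0.
pose k := e' / B; have k0 : 0 < k by rewrite divr_gt0.
have [rho [rho0 rho1 rhod rhok]] : exists rho : R, [/\ 0 <= rho, rho < 1, 1 - rho <= d / 2
    & 8 * (1 - rho) / d ^+ 2 <= k].
  pose m := Num.min 1 (Num.min (d / 2) (k * d ^+ 2 / 8)).
  have m0 : 0 < m by rewrite !lt_min ltr01 !divr_gt0// mulr_gt0// exprn_gt0.
  have [m1 m2 m3] : [/\ m <= 1, m <= d / 2 & m <= k * d ^+ 2 / 8].
    by split; rewrite /m !ge_min ?lexx ?orbT.
  exists (1 - m); split; [lra|lra|lra|].
  rewrite subKr ler_pdivrMr ?exprn_gt0//; lra.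
pose V (z : R[i]^o) := complex.Re (cayley (Complex rho 0 * z)).
have Vc := Re_kernel_continuous rho0 rho1.
have V0 t : 0 <= V (cis t).
  by apply: Re_cayley_ge0; apply: cabs_scale_lt1 => //; rewrite cabs_cis.
have [d2 d20 Vd] := closed_disk_unif_continuous Vc k0.
(* The halves [d / 2] and [d2 / 2] absorb the Lipschitz constant 2 of [cis]. *)
have [N [N0 Nd Nd2]] : exists N, [/\ (0 < N)%N, 2 * pi / N%:R <= d / 2 & 2 * pi / N%:R <= d2 / 2].
  pose m := Num.min (d / 2) (d2 / 2).
  have m0 : 0 < m by rewrite lt_min !divr_gt0.
  exists (Num.truncn (2 * pi / m)).+1.
  have : 2 * pi / (Num.truncn (2 * pi / m)).+1%:R <= m.
    by rewrite ler_pdivrMr// [m * _]mulrC -ler_pdivrMr//; apply: ltW; exact: truncnS_gt.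
  by rewrite le_min => /andP[].
have N0' : 0 < N%:R :> R by rewrite ltr0n.
pose th (j : 'I_N) : R := 2 * pi / N%:R * j%:R.
(* The constant [3 * e'] makes up for three losses of [e'] each in the lower bound on the circle:
   the variation of [U] over near nodes, the far nodes, and the deviation from 1 of the total
   weight. *)
pose G (z : R[i]) := Complex (3 * e') 0 +
  \sum_(j < N) Complex (U (cis (th j)) / N%:R) 0 * cayley (Complex rho 0 * (cis (- th j) * z)).
have ReG z : complex.Re (G z) = 3 * e' + \sum_(j < N) U (cis (th j)) / N%:R *
    complex.Re (cayley (Complex rho 0 * (cis (- th j) * z))).
  by rewrite raddfD raddf_sum /=; congr (_ + _); apply: eq_bigr => j _; rewrite ReMr.
have rot (z : R[i]) j : cabs z <= 1 -> cabs (cis (- th j) * z) <= 1.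
  by rewrite cabsM cabs_cis mul1r.
exists G, (3 * e' + (\sum_(j < N) U (cis (th j))) / N%:R); split.
- move=> z z1; apply: cderivableD; first exact: cderivable_cst.
  apply: cderivable_sum => j; apply: cderivableM; first exact: cderivable_cst.
  apply: (@cderivable_scale _ (fun z => cayley (Complex rho 0 * z))).
  exact: (cderivable_kernel rho0 rho1 (rot z j z1)).
- move=> z z1; rewrite ReG addr_ge0//; first by rewrite mulr_ge0// ltW.
  apply: sumr_ge0 => j _; rewrite mulr_ge0 ?divr_ge0//.
  by apply: Re_cayley_ge0; exact: (cabs_scale_lt1 rho0 rho1 (rot z j z1)).
- rewrite /G mulr_suml.
  under eq_bigr do rewrite !mulr0 cayley0 mulr1.
  rewrite -[RHS]/((3 * e' + \sum_(j < N) U (cis (th j)) / N%:R)%:C%C).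
  by rewrite rmorphD rmorph_sum.
(* Where [U] is at most [e'] the constant suffices; elsewhere [U (cis t) - e'] is positive and
   inequalities may be multiplied by it. *)
- move=> t; rewrite ReG; have [ut|ut] := leP (U (cis t)) e'.
    apply: (@le_trans _ _ (3 * e')); first by lra.
    rewrite lerDl; apply: sumr_ge0 => j _; rewrite mulr_ge0 ?divr_ge0//.
    by rewrite -cisD; exact: V0.
  pose c j := V (cis (t - th j)) / N%:R.
  have c0 j : 0 <= c j by rewrite divr_ge0.
  (* The weights form a Riemann sum for the mean of the Poisson kernel, which is 1. *)
  have S1 : 1 - k <= \sum_(j < N) c j.
    have := @riemann_sum (fun s => V (cis (t - s))) (2 * pi) k (d2 / 2) N (ltW pi2) _ N0 Nd2.
    rewrite kernel_total//.
    have cV : continuous (fun s => V (cis (t - s))).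
      move=> s; apply: (@continuous_comp _ _ _ (fun s => cis (t - s) : R[i]^o) V).
        apply: (@continuous_comp _ _ _ (fun s => t - s) (@cis R : R -> R[i]^o)).
          by apply: cvgB; [exact: cvg_cst|exact: cvg_id].
        exact: continuous_cis.
      by apply: Vc; rewrite cabs_cis.
    have modV s s' : `|s - s'| <= d2 / 2 -> `|V (cis (t - s)) - V (cis (t - s'))| <= k.
      move=> ss; apply: Vd; rewrite ?cabs_cis//.
      apply: le_trans (cis_lipschitz _ _) _.
      by rewrite opprB addrC subrKA distrC; lra.
    move=> /(_ cV modV); rewrite ler_norml => /andP[_].
    have -> : 2 * pi - 2 * pi / N%:R * (\sum_(j < N) V (cis (t - 2 * pi / N%:R * j%:R))) =
      2 * pi * (1 - \sum_(j < N) c j) by rewrite /c -mulr_suml; ring.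
    by rewrite ler_pM2l//; lra.
  (* Near nodes use the continuity of [U], far nodes the smallness of the kernel. Subtracting
     [k * B / N] makes one bound valid for both, so the sum need not be divided. *)
  have term j : c j * (U (cis t) - e') - k * B / N%:R <=
      U (cis (th j)) / N%:R * complex.Re (cayley (Complex rho 0 * (cis (- th j) * cis t))).
    have -> : U (cis (th j)) / N%:R * complex.Re (cayley (Complex rho 0 * (cis (- th j) * cis t))) =
        U (cis (th j)) * c j.
      by rewrite -cisD [- th j + t]addrC /c mulrA mulrAC.
    have kB : 0 <= k * B / N%:R by rewrite divr_ge0// mulr_ge0// ltW.
    have [near|far] := leP (cabs (cis (th j) - cis t)) d.
      have := Ud (cis (th j)) (cis t); rewrite !cabs_cis => /(_ (lexx _) (lexx _) near).
      rewrite ler_norml => /andP[h _].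
      have := ler_wpM2l (c0 j) (_ : U (cis t) - e' <= U (cis (th j))).
      move=> /(_ ltac:(lra)); rewrite [U _ * c j]mulrC; lra.
    have cj : c j <= k / N%:R.
      rewrite ler_pM2r ?invr_gt0//; apply: le_trans rhok.
      apply: kernel_far => //; rewrite ?cabs_cis//.
      apply: le_trans (ltW far) _.
      have -> : cis (th j) - cis t = - cis (th j) * (cis (t - th j) - 1).
        by rewrite mulrBr mulNr -cisD subrKC; ring.
      by rewrite cabsM cabsN cabs_cis mul1r -cabsN opprB.
    have h1 : c j * (U (cis t) - e') <= k / N%:R * B.
      by apply: ler_pM => //; [lra|have := UB t; lra].
    have := mulr_ge0 (U0 (th j)) (c0 j); rewrite (mulrAC k B); lra.
  have := @ler_sum _ _ (index_enum 'I_N) xpredT _ _ (fun j _ => term j).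
  rewrite big_split /= -mulr_suml sumrN sumr_const card_ord -[_ *+ N]mulr_natr divfK ?gt_eqF//.
  have kBe : k * B = e' by rewrite /k divfK// gt_eqF.
  rewrite kBe.
  have : (1 - k) * (U (cis t) - e') <= (\sum_(j < N) c j) * (U (cis t) - e').
    by rewrite ler_wpM2r// subr_ge0 ltW.
  have : k * (U (cis t) - e') <= e'.
    rewrite -kBe ler_wpM2l ?(ltW k0)//; have := UB t; lra.
  lra.
- have := @riemann_sum (fun s => U (cis s)) (2 * pi) e' (d / 2) N (ltW pi2) _ N0 Nd.
  have cU : continuous (fun s => U (cis s)).
    move=> s; apply: (@continuous_comp _ _ _ (@cis R : R -> R[i]^o) U); first exact: continuous_cis.
    by apply: Uc; rewrite cabs_cis.
  move=> /(_ cU).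
  have modU s t : `|s - t| <= d / 2 -> `|U (cis s) - U (cis t)| <= e'.
    move=> st; apply: Ud; rewrite ?cabs_cis//.
    by apply: le_trans (cis_lipschitz _ _) _; lra.
  move=> /(_ modU); rewrite ler_norml => /andP[+ _].
  rewrite -/th.
  have -> : e = 8 * pi * e' by rewrite /e' mulrC divfK// mulf_neq0// gt_eqF.
  rewrite (_ : 2 * pi * (3 * e' + (\sum_(j < N) U (cis (th j))) / N%:R) =
     2 * pi / N%:R * \sum_(j < N) U (cis (th j)) + 6 * pi * e'); last by ring.
  rewrite /th => H; lra.
Qed.

End Herglotz.

(** * The John-Nirenberg inequality *)

Section MeasurableCabs.
Variable R : realType.

Lemma measurable_cabs (D : set R) (g : R -> R[i]) :
  measurable_fun D (fun t => complex.Re (g t)) ->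
  measurable_fun D (fun t => complex.Im (g t)) ->
  measurable_fun D (fun t => cabs (g t)).
Proof.
move=> mr mi; rewrite (_ : (fun t => _) =
    Num.sqrt \o (fun t => complex.Re (g t) ^+ 2 + complex.Im (g t) ^+ 2)).
  apply: measurableT_comp; first by apply: continuous_measurable_fun; exact: sqrt_continuous.
  by apply: measurable_funD; exact: measurable_funX.
by apply/funext => t /=; rewrite -cabs_sqr sqrtr_sqr ger0_norm// cabs_ge0.
Qed.

End MeasurableCabs.

Section FatouLimit.
Variable R : realType.
Notation mu := (@lebesgue_measure R).

(** Fatou's lemma, for real functions that converge almost everywhere. *)
Lemma integral_limit_le (D : set R) (h : nat -> R -> R) (g : R -> R) (K : \bar R) :
  measurable D -> (forall n, measurable_fun D (h n)) -> measurable_fun D g ->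
  (forall n x, 0 <= h n x) -> (forall x, 0 <= g x) ->
  {ae mu, forall x, D x -> h n x @[n --> \oo] --> g x} ->
  (forall n, (\int[mu]_(x in D) (h n x)%:E <= K)%E) ->
  (\int[mu]_(x in D) (g x)%:E <= K)%E.
Proof.
move=> mD mh mg h0 g0 hg hK.
have mh' n : measurable_fun D (fun x => (h n x)%:E) by exact/measurable_EFinP.
have mg' : measurable_fun D (fun x => (g x)%:E) by exact/measurable_EFinP.
have einfE : (fun x => limn_einf (fun n => (h n x)%:E)) =
    (fun x => - limn_esup (fun n => - (h n x)%:E))%E.
  apply/funext => x; rewrite -(limn_einfN (fun n => - (h n x)%:E)%E).
  by congr limn_einf; apply/funext => n /=; rewrite opprK.
have -> : (\int[mu]_(x in D) (g x)%:E = \int[mu]_(x in D) limn_einf (fun n => (h n x)%:E))%E.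
  apply: ge0_ae_eq_integral => //.
  - rewrite einfE; apply: measurableT_comp => //.
    apply: (@measurable_fun_limn_esup _ _ _ D (fun n x => - (h n x)%:E)%E) => n.
    exact: measurableT_comp.
  - by move=> x _; rewrite lee_fin.
  - move=> x _; rewrite limn_einf_lim; apply: lime_ge; first exact: is_cvg_einfs.
    by apply: nearW => n; apply: le_ereal_inf_tmp => _ [m _ <-]; rewrite lee_fin.
  - case: hg => N [mN N0 sN]; exists N; split => //.
    apply: subset_trans sN => x /= nx hx; apply: nx => Dx.
    rewrite (cvg_limn_einf_sup (l := (g x)%:E) _).1//.
    by apply: cvg_EFin; [exact: nearW|exact: hx].
apply: le_trans (fatou mu mD mh' _) _; first by move=> n x _; rewrite lee_fin.
rewrite limn_einf_lim; apply: lime_le; first exact: is_cvg_einfs.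
apply: nearW => n; apply: le_trans (hK n).
by rewrite /einfs; apply: ereal_inf_lbound; exists n => //=; exact: leqnn.
Qed.

End FatouLimit.

Section JohnNirenberg.
Variable R : realType.
Notation mu := (@lebesgue_measure R).
Variable f : R[i] -> R[i].
Hypothesis mRe : measurable_fun setT (fun t => complex.Re (f (cis t))).
Hypothesis mIm : measurable_fun setT (fun t => complex.Im (f (cis t))).
Implicit Types (a b : R) (w : R[i]).
Hypothesis bmo : forall a b : R, a < b -> b <= a + 2 * pi ->
  (mean_oscillation f a b <= 1)%E.

Let phi t := f (cis t).

Lemma measurable_dist w : measurable_fun setT (fun t => cabs (phi t - w)).
Proof.
apply: measurable_cabs.
  under eq_fun do rewrite raddfB; apply: measurable_funB => //.
under eq_fun do rewrite raddfB; exact: measurable_funB.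
Qed.

Lemma integral_dist_mean a b : a < b -> b <= a + 2 * pi ->
  (\int[mu]_(t in `[a, b]) (cabs (phi t - arc_mean f a b))%:E <= (b - a)%:E)%E.
Proof.
move=> ab bpi; have := bmo ab bpi; rewrite /mean_oscillation.
by rewrite lee_pdivrMl ?subr_gt0// mule1.
Qed.

Lemma integrable_dist a b w : a < b -> b <= a + 2 * pi ->
  mu.-integrable `[a, b] (EFin \o (fun t => cabs (phi t - w))).
Proof.
move=> ab bpi; set m := arc_mean f a b.
have mw u : measurable_fun `[a, b] (EFin \o (fun t => cabs (phi t - u))).
  by apply/measurable_EFinP; apply: measurable_funTS; exact: measurable_dist.
have im : mu.-integrable `[a, b] (EFin \o (fun t => cabs (phi t - m))).
  apply/integrableP; split; first exact: mw.
  under eq_integral do rewrite /= ger0_norm ?cabs_ge0//.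
  by apply: le_lt_trans (integral_dist_mean ab bpi) _; rewrite ltry.
have ic : mu.-integrable `[a, b] (EFin \o cst (cabs (m - w))).
  by apply: continuous_itv_integrable => x _; exact: cst_continuous.
have isum : mu.-integrable `[a, b] ((EFin \o (fun t => cabs (phi t - m)%R)) \+
    (EFin \o cst (cabs (m - w)%R)))%E by exact: integrableD.
apply: le_integrable isum => //; first exact: mw.
  move=> t _ /=; rewrite lee_fin !ger0_norm ?addr_ge0 ?cabs_ge0//.
  by rewrite (_ : phi t - w = (phi t - m) + (m - w)) ?cabsD//; ring.
Qed.

Lemma integrable_dist_parts a b : a < b -> b <= a + 2 * pi ->
  mu.-integrable `[a, b] (EFin \o (fun t => complex.Re (phi t))) /\
  mu.-integrable `[a, b] (EFin \o (fun t => complex.Im (phi t))).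
Proof.
move=> ab bpi; have := integrable_dist 0 ab bpi => i0.
split; (apply: le_integrable i0 => //; [by apply/measurable_EFinP; exact: measurable_funTS|]).
  by move=> t _ /=; rewrite subr0 lee_fin [leRHS]ger0_norm ?cabs_ge0// cabs_Re.
by move=> t _ /=; rewrite subr0 lee_fin [leRHS]ger0_norm ?cabs_ge0// cabs_Im.
Qed.

(** Not divided by the length, so that it is additive over adjacent intervals. *)
Let osc a b w := \int[mu]_(t in `[a, b]) cabs (phi t - w).

Lemma osc_ge0 a b w : 0 <= osc a b w.
Proof. by apply: Rintegral_ge0 => t _; exact: cabs_ge0. Qed.

Lemma osc_mean a b : a < b -> b <= a + 2 * pi -> osc a b (arc_mean f a b) <= b - a.
Proof.
move=> ab bpi; rewrite -lee_fin /osc /Rintegral fineK ?integral_dist_mean//.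
by have /integrable_fin_num := integrable_dist (arc_mean f a b) ab bpi; apply.
Qed.

Lemma osc_split a m b w : a < m -> m < b -> b <= a + 2 * pi ->
  osc a b w = osc a m w + osc m b w.
Proof.
move=> am mb bpi; apply: Rintegral_split; [exact: ltW|exact: ltW|].
by apply: integrable_dist => //; exact: lt_trans am mb.
Qed.

(** The factor 2 comes from estimating the real and the imaginary part separately. *)
Lemma mean_dist a b w : a < b -> b <= a + 2 * pi ->
  cabs (arc_mean f a b - w) * (b - a) <= 2 * osc a b w.
Proof.
move=> ab bpi; have ba : 0 < b - a by rewrite subr_gt0.
have [iR iI] := integrable_dist_parts ab bpi.
have iw := integrable_dist w ab bpi.
have aux (g : R -> R) (k : R) : mu.-integrable `[a, b] (EFin \o g) ->
    (forall t, `|g t - k| <= cabs (phi t - w)) ->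
    `|(b - a)^-1 * (\int[mu]_(t in `[a, b]) g t) - k| * (b - a) <= osc a b w.
  move=> ig gk; rewrite -{2}(gtr0_norm ba) -normrM mulrBl mulrAC mulVf ?gt_eqF// mul1r.
  have ik : mu.-integrable `[a, b] (EFin \o cst k).
    by apply: continuous_itv_integrable => x _; exact: cst_continuous.
  rewrite -(Rintegral_itv_cst k (ltW ab)) -RintegralB//.
  have igk : mu.-integrable `[a, b] (EFin \o (fun t => g t - k)).
    by have := integrableB _ ig ik; apply.
  apply: (le_trans (le_normr_Rintegral _ _)) => //.
  apply: le_Rintegral => //.
  by have := integrable_norm igk; apply.
apply: (@le_trans _ _ ((`|complex.Re (arc_mean f a b - w)| + `|complex.Im (arc_mean f a b - w)|) * (b - a))).
  by apply: ler_wpM2r; [exact: ltW|exact: cabs_le_ReIm].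
rewrite mulrDl (_ : 2 = 1 + 1)// mulrDl mul1r !raddfB /=.
apply: lerD; apply: aux => // t; rewrite -raddfB; [exact: cabs_Re|exact: cabs_Im].
Qed.

(** * Dyadic exponential sums *)

Variable c : R.
Hypothesis c_ge0 : 0 <= c.
Hypothesis c8 : expR (c * 8) <= 3 / 2.

(* [dyadic_sum n w a b] is the integral over [a, b] of [exp (c |f_n - w|)], where [f_n] is
   constant on each of the [2 ^ n] equal pieces of [a, b], equal to the mean of [f] there. *)
Fixpoint dyadic_sum n (w : R[i]) (a b : R) : R :=
  if n is n'.+1 then
    dyadic_sum n' w a ((a + b) / 2) + dyadic_sum n' w ((a + b) / 2) b
  else (b - a) * expR (c * cabs (arc_mean f a b - w)).

Lemma dyadic_sum_shift n w w' a b : a < b ->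
  dyadic_sum n w a b <= expR (c * cabs (w' - w)) * dyadic_sum n w' a b.
Proof.
elim: n a b => [|n IH] a b ab /=.
  rewrite mulrCA ler_wpM2l ?subr_ge0 ?(ltW ab)// -expRD ler_expR -mulrDr ler_wpM2l//.
  by rewrite (_ : _ - w = (w' - w) + (arc_mean f a b - w')) ?cabsD//; ring.
by rewrite mulrDr lerD// IH//; lra.
Qed.

(* A piece on which the mean of [|f - w|] exceeds 2 is restarted from its own mean: the loss
   [exp (8 c) <= 3/2] in doing so is paid for by the linear term. *)
Lemma dyadic_sum_le n w a b : a < b -> b <= a + 2 * pi -> osc a b w <= 2 * (b - a) ->
  dyadic_sum n w a b <= 3 / 2 * ((b - a) + osc a b w).
Proof.
elim: n w a b => [|n IH] w a b ab bpi ow /=.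
  have ba : 0 < b - a by rewrite subr_gt0.
  have : cabs (arc_mean f a b - w) <= 4.
    rewrite -(ler_pM2r ba); apply: le_trans (mean_dist w ab bpi) _; lra.
  move=> m4; have : expR (c * cabs (arc_mean f a b - w)) <= 3 / 2.
    apply: le_trans c8; rewrite ler_expR ler_wpM2l//; lra.
  move=> /(ler_wpM2l (ltW ba)); have := osc_ge0 a b w; lra.
set m := (a + b) / 2.
have am : a < m by rewrite /m; lra.
have mb : m < b by rewrite /m; lra.
have hm1 : m - a = (b - a) / 2 by rewrite /m; lra.
have hm2 : b - m = (b - a) / 2 by rewrite /m; lra.
have E := osc_split w am mb bpi.
(* Passing to a half at most doubles the mean of [|f - w|], hence 4 instead of 2; the mean of [f] on
   the half is then within 8 of [w]. *)
have child x y : x < y -> y <= x + 2 * pi -> osc x y w <= 4 * (y - x) ->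
    dyadic_sum n w x y <= 3 / 2 * ((y - x) + osc x y w).
  move=> xy ypi o4; have yx : 0 < y - x by rewrite subr_gt0.
  have [le2|gt2] := leP (osc x y w) (2 * (y - x)); first exact: IH.
  set w' := arc_mean f x y.
  have w8 : cabs (w' - w) <= 8.
    rewrite -(ler_pM2r yx); apply: le_trans (mean_dist w xy ypi) _; lra.
  have o1 : osc x y w' <= y - x by exact: osc_mean.
  have H : dyadic_sum n w' x y <= 3 / 2 * ((y - x) + osc x y w') by apply: IH => //; lra.
  apply: le_trans (dyadic_sum_shift n w w' xy) _.
  have e8 : expR (c * cabs (w' - w)) <= 3 / 2.
    by apply: le_trans c8; rewrite ler_expR ler_wpM2l.
  (* The left side is [9 / 2 * (y - x)], which is exactly the value of the right side at
     [osc x y w = 2 * (y - x)], the threshold for a restart. *)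
  apply: (@le_trans _ _ (3 / 2 * (3 / 2 * ((y - x) + (y - x))))); last by lra.
  apply: (@le_trans _ _ (expR (c * cabs (w' - w)) * (3 / 2 * ((y - x) + (y - x))))).
    rewrite ler_wpM2l ?expR_ge0//; lra.
  by rewrite ler_wpM2r//; lra.
have o1 := osc_ge0 a m w; have o2 := osc_ge0 m b w.
have C1 := child a m am ltac:(lra) ltac:(lra).
have C2 := child m b mb ltac:(lra) ltac:(lra).
lra.
Qed.


(** * Convergence of the dyadic means *)

Fixpoint dyadic_interval n (a b x : R) : R * R :=
  if n is n'.+1 then
    if x < (a + b) / 2 then dyadic_interval n' a ((a + b) / 2) x
    else dyadic_interval n' ((a + b) / 2) b x
  else (a, b).

Lemma dyadic_intervalP n a b x : a <= x < b ->
  [/\ a <= (dyadic_interval n a b x).1, (dyadic_interval n a b x).2 <= b,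
      (dyadic_interval n a b x).1 <= x < (dyadic_interval n a b x).2 &
      (dyadic_interval n a b x).2 - (dyadic_interval n a b x).1 = (b - a) / 2 ^+ n].
Proof.
elim: n a b => [|n IH] a b /andP[ax xb] /=.
  by rewrite expr0 divr1 !lexx ax xb.
have h2 : (b - a) / 2 ^+ n.+1 = (b - a) / 2 / 2 ^+ n.
  by rewrite exprS invfM mulrA.
have [xm|xm] := ltP x ((a + b) / 2).
  have /IH[A B C ->] : a <= x < (a + b) / 2 by rewrite ax.
  split => //; first by apply: le_trans B _; lra.
  by rewrite h2; congr (_ / _); lra.
have /IH[A B C ->] : (a + b) / 2 <= x < b by rewrite xm.
split => //; first by apply: le_trans A; lra.
by rewrite h2; congr (_ / _); lra.
Qed.

Definition dyadic_mean n a b x :=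
  arc_mean f (dyadic_interval n a b x).1 (dyadic_interval n a b x).2.

Lemma measurable_dyadic_mean n w a b :
  measurable_fun setT (fun x => expR (c * cabs (dyadic_mean n a b x - w))).
Proof.
elim: n a b => [|n IH] a b; first by rewrite /dyadic_mean /=; exact: measurable_cst.
rewrite (_ : (fun x => _) = (fun x => if x < (a + b) / 2
    then expR (c * cabs (dyadic_mean n a ((a + b) / 2) x - w))
    else expR (c * cabs (dyadic_mean n ((a + b) / 2) b x - w)))).
  apply: measurable_fun_ifT => //.
  by apply: measurable_fun_ltr => //; exact: measurable_cst.
by apply/funext => x; rewrite /dyadic_mean /=; case: ifP.
Qed.

Lemma integral_dyadic_mean n w a b : a < b ->
  (\int[mu]_(x in `[a, b[) (expR (c * cabs (dyadic_mean n a b x - w)))%:E =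
  (dyadic_sum n w a b)%:E)%E.
Proof.
elim: n a b => [|n IH] a b ab.
  transitivity (\int[mu]_(x in `[a, b[) cst (expR (c * cabs (arc_mean f a b - w)))%:E x)%E => //.
  by rewrite integral_cst//= lebesgue_measure_itv /= lte_fin ab -EFinB -EFinM mulrC.
set m := (a + b) / 2.
have am : a < m by rewrite /m; lra.
have mb : m < b by rewrite /m; lra.
have -> : `[a, b[%classic = `[a, m[ `|` `[m, b[.
  by rewrite -itv_bndbnd_setU// bnd_simp ltW.
transitivity (\int[mu]_(x in `[a, m[) (expR (c * cabs (dyadic_mean n.+1 a b x - w)))%:E +
              \int[mu]_(x in `[m, b[) (expR (c * cabs (dyadic_mean n.+1 a b x - w)))%:E)%E.
  apply: ge0_integral_setU => //.
  - apply/measurable_EFinP; apply: measurable_funTS; exact: measurable_dyadic_mean.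
  - by apply/disj_setPS => x [/=]; rewrite !in_itv /= => /andP[_ ?] /andP[? _]; lra.
transitivity ((dyadic_sum n w a m)%:E + (dyadic_sum n w m b)%:E)%E; last by [].
congr (_ + _)%E.
  apply: etrans (IH a m am); apply: eq_integral => x; rewrite inE /= in_itv /= => /andP[x1 x2].
  by rewrite /dyadic_mean /= -/m x2.
apply: etrans (IH m b mb); apply: eq_integral => x; rewrite inE /= in_itv /= => /andP[x1 x2].
by rewrite /dyadic_mean /= -/m ltNge x1.
Qed.

(** Lebesgue differentiation: the dyadic intervals around [x] are not centred at [x], but they
    occupy a fixed proportion of the ball whose radius is their length. *)
Lemma dyadic_average_cvg (g : R -> R) a b : a < b ->
  mu.-integrable `[a, b] (EFin \o g) ->
  {ae mu, forall x, `[a, b[%classic x ->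
    ((dyadic_interval n a b x).2 - (dyadic_interval n a b x).1)^-1 *
    \int[mu]_(t in `[(dyadic_interval n a b x).1, (dyadic_interval n a b x).2]) g t
    @[n --> \oo] --> g x}.
Proof.
move=> ab ig; have ba : 0 < b - a by rewrite subr_gt0.
have r0 n : 0 < (b - a) / 2 ^+ n by rewrite divr_gt0// exprn_gt0.
pose r n : {posnum R} := PosNum (r0 n).
(* Balls are used outside [[a, b[], so that the family shrinks nicely at every point. *)
pose E x n : set R := if (a <= x < b) then
  `[(dyadic_interval n a b x).1, (dyadic_interval n a b x).2[%classic
  else ball x (r n)%:num.
have muE x n : a <= x < b -> mu (E x n) = ((dyadic_interval n a b x).2 - (dyadic_interval n a b x).1)%:E.
  move=> xab; have [_ _ /andP[p1 p2] _] := dyadic_intervalP n xab.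
  by rewrite /E xab lebesgue_measure_itv /= lte_fin (le_lt_trans p1 p2) EFinB.
have niceE x : nicely_shrinking x (E x).
  split; first by move=> n; rewrite /E; case: ifP => _; [exact: measurable_itv|exact: measurable_ball].
  (* The ball of radius [r n] has twice the length of the dyadic interval. *)
  exists (2, r); split => //=.
  - have h : (fun n => (b - a) * (2^-1) ^+ n) @ \oo --> (b - a) * 0.
      by apply: cvgMr; apply: cvg_expr; rewrite ger0_norm// invf_lt1// ltr1n.
    rewrite mulr0 in h; apply: cvg_trans h; apply: near_eq_cvg; apply: nearW => n.
    by rewrite /= exprVn.
  - move=> n y; rewrite /E; case: ifP => // xab /=; rewrite in_itv /= => /andP[y1 y2].
    have [_ _ /andP[p1 p2] pe] := dyadic_intervalP n xab.
    by rewrite /ball /= -pe ltr_norml; apply/andP; split; lra.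
  - move=> n; have mb : mu (ball x (r n)%:num) = ((b - a) / 2 ^+ n *+ 2)%:E.
      by rewrite lebesgue_measure_ball.
    have := r0 n => rn.
    have [xab|xab] := boolP (a <= x < b); last first.
      by rewrite /E (negbTE xab) mb -EFinM lee_fin mulr2n; lra.
    rewrite muE// mb; have [_ _ _ ->] := dyadic_intervalP n xab.
    by rewrite -EFinM lee_fin mulr2n; lra.
have loc := integrable_locally_restrict (measurable_itv `[a, b]) ig.
have := lebesgue_differentiation loc.
case=> N [mN N0 sN]; exists N; split => //; apply: subset_trans sN => x /= nx pt; apply: nx.
rewrite in_itv /= => xab.
have := nice_lebesgue_differentiation niceE loc pt.
rewrite patchE mem_set; last by rewrite /= in_itv /=; case/andP: xab => -> /ltW ->.
move=> /fine_cvg; apply: cvg_trans; apply: near_eq_cvg; apply: nearW => n /=.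
have [p1 p2 /andP[p3 p4] pe] := dyadic_intervalP n xab.
rewrite muE//.
set p := dyadic_interval n a b x in p1 p2 p3 p4 pe *.
have p12 : p.1 < p.2 by exact: le_lt_trans p3 p4.
have igp : mu.-integrable `[p.1, p.2] (EFin \o g).
  apply: integrableS ig => // t /=; rewrite !in_itv /= => /andP[t1 t2].
  by rewrite (le_trans p1 t1) (le_trans t2 p2).
have -> : (\int[mu]_(y in E x n) ((g \_ `[a, b]) y)%:E = \int[mu]_(y in `[p.1, p.2]) (g y)%:E)%E.
  rewrite -integral_itv_bndo_bndc; last first.
    by apply: measurable_funS (measurable_int _ igp) => //; apply: subset_itvl; rewrite bnd_simp.
  rewrite /E xab; apply: eq_integral => y; rewrite inE /= in_itv /= => /andP[y1 y2].
  by rewrite patchE mem_set//= in_itv /= (le_trans p1 y1) (le_trans (ltW y2) p2).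
rewrite inver subr_eq0 (gt_eqF p12) fineM//; exact: integrable_fin_num igp.
Qed.

Lemma dyadic_mean_cvg a b : a < b -> b <= a + 2 * pi ->
  {ae mu, forall x, `[a, b[%classic x ->
    (dyadic_mean n a b x : R[i]^o) @[n --> \oo] --> (phi x : R[i]^o)}.
Proof.
move=> ab bpi; have [iR iI] := integrable_dist_parts ab bpi.
have [N1 [mN1 N10 s1]] := dyadic_average_cvg ab iR.
have [N2 [mN2 N20 s2]] := dyadic_average_cvg ab iI.
exists (N1 `|` N2); split; first exact: measurableU.
  by rewrite null_set_setU.
move=> x /= nx; apply: contrapT => /not_orP[n1 n2]; apply: nx => xab.
have h1 := contrapT (fun h => n1 (s1 x h)) xab.
have h2 := contrapT (fun h => n2 (s2 x h)) xab.
by apply/cvg_complexP; split; [exact: h1|exact: h2].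
Qed.

(** Fatou's lemma carries the bound on the dyadic sums, uniform in [n], over to [f]. With [w] the
    mean over the whole interval, [osc] is at most [b - a], so the bound is [3 / 2] times
    [2 * (b - a)]. *)
Theorem john_nirenberg a b : a < b -> b <= a + 2 * pi ->
  (\int[mu]_(x in `[a, b[) (expR (c * cabs (phi x - arc_mean f a b)))%:E <=
   (3 * (b - a))%:E)%E.
Proof.
move=> ab bpi; set m := arc_mean f a b.
have mexp (g : R -> R) : measurable_fun setT g -> measurable_fun setT (fun x => expR (c * g x)).
  move=> mg; apply: (measurableT_comp (f := expR)) => //.
  by apply: measurable_funM => //; exact: measurable_cst.
apply: (@integral_limit_le R `[a, b[%classic (fun n x => expR (c * cabs (dyadic_mean n a b x - m)))).
- exact: measurable_itv.
- by move=> n; apply: measurable_funTS; exact: measurable_dyadic_mean.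
- by apply: measurable_funTS; apply: mexp; exact: measurable_dist.
- by move=> n x; exact: expR_ge0.
- by move=> x; exact: expR_ge0.
- have [N [mN N0 sN]] := dyadic_mean_cvg ab bpi.
  exists N; split => //; apply: subset_trans sN => x /= nx cx; apply: nx => xab.
  have {}cx := cx xab.
  apply: continuous_cvg; first exact: continuous_expR.
  apply: cvgMr.
  apply: (@cvg_cabs R nat \oo _ (fun n => dyadic_mean n a b x - m) (phi x - m)).
  by apply: (@cvgB _ R[i]^o _ _ _ _ (fun=> m) _ _ cx); exact: cvg_cst.
- move=> n; rewrite integral_dyadic_mean// lee_fin.
  have om := osc_mean ab bpi.
  apply: le_trans (dyadic_sum_le n ab bpi _) _; rewrite -/m in om *; lra.
Qed.

End JohnNirenberg.

(** * Truncation of analytic functions *)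

Section Truncation.
Variable R : realType.
Notation mu := (@lebesgue_measure R).
Implicit Types (p : R[i] -> R[i]) (lam : R).

(** For [x >= 0] and [lam > 0], this is the least [u >= 0] such that [x <= lam * (1 + u) ^+ 2]. *)
Definition sqrt_excess lam (x : R) : R := Num.max 0 (Num.sqrt (x / lam) - 1).

Lemma sqrt_excess_ge0 lam x : 0 <= sqrt_excess lam x.
Proof. by rewrite /sqrt_excess le_max lexx. Qed.

Lemma le_sqrt_excess lam x u : 0 < lam -> 0 <= x -> sqrt_excess lam x <= u ->
  x <= lam * (1 + u) ^+ 2.
Proof.
move=> lam0 x0; rewrite /sqrt_excess ge_max lerBlDl => /andP[u0 h].
have xl : 0 <= x / lam by rewrite divr_ge0// ltW.
rewrite mulrC -ler_pdivrMr// -(sqr_sqrtr xl) lerXn2r ?nnegrE ?sqrtr_ge0//.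
by rewrite addr_ge0.
Qed.

Lemma continuous_sqrt_excess lam : continuous (sqrt_excess lam).
Proof.
move=> x; apply: (@continuous_max _ _ (fun=> 0 : R^o)
  (fun x : R => Num.sqrt (x / lam) - 1 : R^o)); first exact: cst_continuous.
apply: cvgB; last exact: cvg_cst.
apply: continuous_comp; last exact: sqrt_continuous.
by apply: cvgMl; exact: cvg_id.
Qed.

Lemma cabs_ge_Re1 (w : R[i]) : 0 <= complex.Re w -> 1 + complex.Re w <= cabs (1 + w).
Proof.
move=> w0; apply: le_trans (cabs_Re _); rewrite raddfD /=; exact: ler_norm.
Qed.

(* [1 / (1 + G) ^ 2] is a bounded analytic function, of modulus at most [lam / |p|] on the
   circle, and close to 1 where [G] is close to 0. *)
Lemma truncating_factor p lam e : 0 < lam -> 0 < e ->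
  (forall z, cabs z <= 1 -> derivable (p : R[i]^o -> R[i]^o) z 1) ->
  exists (G : R[i] -> R[i]) (g0 : R),
    [/\ forall z, cabs z <= 1 -> derivable (G : R[i]^o -> R[i]^o) z 1,
        forall z, cabs z <= 1 -> 0 <= complex.Re (G z),
        G 0 = Complex g0 0,
        forall t, cabs (p (cis t)) <= lam * cabs (1 + G (cis t)) ^+ 2 &
        2 * pi * g0 <=
          \int[mu]_(t in `[0, 2 * pi]) sqrt_excess lam (cabs (p (cis t))) + e].
Proof.
move=> lam0 e0 dp.
have [||//|G [g0 [dG ReG G0 UG g0e]]] :=
    @herglotz R (fun z => sqrt_excess lam (cabs (p z))) e.
- move=> z z1; apply: (@continuous_comp _ _ _ (fun z : R[i]^o => cabs (p z)) (sqrt_excess lam)).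
    by apply: (@cvg_cabs _ _ (nbhs (z : R[i]^o)) _ p (p z)); apply: cderivable_continuous; exact: dp.
  exact: continuous_sqrt_excess.
- by move=> t; exact: sqrt_excess_ge0.
exists G, g0; split => // t.
have Gt : 0 <= complex.Re (G (cis t)) by apply: ReG; rewrite cabs_cis.
apply: (le_trans (le_sqrt_excess lam0 (cabs_ge0 _) (UG t))).
rewrite ler_pM2l// lerXn2r ?nnegrE ?cabs_ge0 ?addr_ge0//.
exact: cabs_ge_Re1.
Qed.

Lemma factor_neq0 (w : R[i]) : 0 <= complex.Re w -> 1 + w != 0.
Proof.
move=> w0; apply/eqP => e; have := cabs_ge_Re1 w0.
by rewrite e cabs0 leNgt ltr_wpDr.
Qed.

Lemma cderivable_factor (p G : R[i] -> R[i]) z :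
  derivable (p : R[i]^o -> R[i]^o) z 1 -> derivable (G : R[i]^o -> R[i]^o) z 1 ->
  0 <= complex.Re (G z) ->
  derivable ((fun z => p z * ((1 + G z)^-1 * (1 + G z)^-1)) : R[i]^o -> R[i]^o) z 1.
Proof.
move=> dp dG Gz.
have d1 : derivable ((fun w => (1 + G w)^-1) : R[i]^o -> R[i]^o) z 1.
  apply: cderivableV; first exact: factor_neq0.
  by apply: (@cderivableD _ (fun=> 1) G); [exact: cderivable_cst|exact: dG].
by apply: cderivableM; [exact: dp|apply: cderivableM; exact: d1].
Qed.

(** Multiplying [F] by the conjugate of [F 0] makes the value at 0 real, so that the mean value
    property of real parts bounds the modulus. *)
Lemma mean_value_bound (F : R[i] -> R[i]) (M : R) :
  (forall z, cabs z <= 1 -> derivable (F : R[i]^o -> R[i]^o) z 1) ->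
  (forall t, cabs (F (cis t)) <= M) -> cabs (F 0) <= M.
Proof.
move=> dF FM; have [->|F0] := eqVneq (F 0) 0.
  by rewrite cabs0; apply: le_trans (FM 0); exact: cabs_ge0.
have pos : 0 < cabs (F 0).
  rewrite lt_neqAle cabs_ge0 andbT eq_sym; apply: contra_neq F0.
  exact: ComplexField.Normc.eq0_normc.
pose k := Complex (complex.Re (F 0)) (- complex.Im (F 0)).
have kE : cabs k = cabs (F 0) by rewrite cabs_conj; case: (F 0).
have kF : complex.Re (k * F 0) = cabs (F 0) ^+ 2.
  by rewrite cabs_sqr /k; case: (F 0) => x y /=; ring.
have dk z : cabs z <= 1 -> derivable ((fun z => k * F z) : R[i]^o -> R[i]^o) z 1.
  by move=> z1; apply: cderivableM; [exact: cderivable_cst|exact: dF].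
have := mean_value dk; rewrite kF => mv.
have pi2 : 0 < 2 * pi :> R by rewrite mulr_gt0// pi_gt0.
have : \int[mu]_(t in `[0, 2 * pi]) complex.Re (k * F (cis t)) <= (cabs (F 0) * M) * (2 * pi - 0).
  rewrite -Rintegral_itv_cst ?(ltW pi2)//; apply: le_Rintegral => //.
  - apply: continuous_itv_integrable => t _.
    apply: (@continuous_Re_cis _ (fun z => k * F z)).
    by apply: cderivable_continuous; apply: dk; rewrite cabs_cis.
  - by apply: continuous_itv_integrable => t _; exact: cst_continuous.
  - move=> t _; apply: le_trans (ler_norm _) _; apply: le_trans (cabs_Re _) _.
    by rewrite cabsM kE ler_pM2l.
rewrite mv subr0 mulrC ler_pM2r// expr2 ler_pM2l//.
Qed.

(** A weak form of the subharmonicity of [|p| ^ (1/2)]: [p / (1 + G) ^ 2] has modulus at most 1 on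
    the circle, hence at 0, where [1 + G] equals [1 + g0]. The tolerance [2 * pi] in the choice of
    [G] costs 1 in [g0], whence the summand 2. *)
Lemma submean p :
  (forall z, cabs z <= 1 -> derivable (p : R[i]^o -> R[i]^o) z 1) ->
  cabs (p 0) <= (2 + (2 * pi)^-1 *
    \int[mu]_(t in `[0, 2 * pi]) sqrt_excess 1 (cabs (p (cis t)))) ^+ 2.
Proof.
move=> dp; have pi2 : 0 < 2 * pi :> R by rewrite mulr_gt0// pi_gt0.
have [G [g0 [dG ReG G0 pG g0e]]] := truncating_factor ltr01 pi2 dp.
have g00 : 0 <= g0 by have := ReG 0; rewrite cabs0 G0; apply; exact: ler01.
have Gp (z : R[i]) : cabs z <= 1 -> 0 < cabs (1 + G z).
  by move=> /ReG h; apply: lt_le_trans (cabs_ge_Re1 h); rewrite ltr_wpDr.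
have := @mean_value_bound (fun z => p z * ((1 + G z)^-1 * (1 + G z)^-1)) 1 _ _.
rewrite !cabsM !cabsV G0 => H.
have {}H : cabs (p 0) * ((cabs (1 + Complex g0 0))^-1 * (cabs (1 + Complex g0 0))^-1) <= 1.
  apply: H => [z z1|t]; first by apply: cderivable_factor; [exact: dp|exact: dG|exact: ReG].
  have Gt := Gp (cis t); rewrite cabs_cis in Gt; have {}Gt := Gt (lexx _).
  by rewrite !cabsM !cabsV -invfM ler_pdivrMr ?mulr_gt0// -expr2 pG.
have E : cabs (1 + Complex g0 0) = 1 + g0.
  have -> : 1 + Complex g0 0 = Complex (1 + g0) 0 by apply/eqP; rewrite eq_complex /= addr0 !eqxx.
  by rewrite cabs_real ger0_norm// addr_ge0.
have g1 : 0 < 1 + g0 by rewrite ltr_wpDr.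
rewrite E -invfM ler_pdivrMr ?mulr_gt0// mul1r -expr2 in H.
apply: (le_trans H); rewrite lerXn2r ?nnegrE ?(ltW g1)//.
  rewrite addr_ge0// mulr_ge0 ?invr_ge0 ?(ltW pi2)//.
  by apply: Rintegral_ge0 => t _; exact: sqrt_excess_ge0.
move: g0e; set I := Rintegral _ _ _ => g0e.
have : g0 <= (2 * pi)^-1 * I + 1.
  have ipi : 0 <= (2 * pi)^-1 :> R by rewrite invr_ge0 ltW.
  have := ler_wpM2l ipi g0e.
  by rewrite mulKf ?lt0r_neq0// mulrDr mulVf ?lt0r_neq0.
lra.
Qed.

(** Where [|G| < s <= 1], the error [g * G * (G + 2)] is below [3 * lam * s]; the rest is covered by
    the weak type inequality, whose [8 * pi * g0] is 4 times the controlled quantity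
    [2 * pi * g0]. *)
Theorem analytic_truncation p lam e : 0 < lam -> 0 < e ->
  (forall z, cabs z <= 1 -> derivable (p : R[i]^o -> R[i]^o) z 1) ->
  exists g : R[i] -> R[i],
    [/\ forall z, cabs z <= 1 -> derivable (g : R[i]^o -> R[i]^o) z 1,
        forall t, cabs (g (cis t)) <= lam &
        forall s, 0 < s -> s <= 1 ->
          (mu (`[0%R, (2 * pi)%R] `&`
               [set t | (3 * lam * s <= cabs (p (cis t) - g (cis t)))%R]) <=
           (4 * (\int[mu]_(t in `[0, 2 * pi]) sqrt_excess lam (cabs (p (cis t))) + e) / s)%:E)%E].
Proof.
move=> lam0 e0 dp.
have [G [g0 [dG ReG G0 pG g0e]]] := truncating_factor lam0 e0 dp.
pose g z := p z * ((1 + G z)^-1 * (1 + G z)^-1).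
have cis1 t : cabs (cis t : R[i]) <= 1 by rewrite cabs_cis.
have Gp t : 0 < cabs (1 + G (cis t)).
  by apply: lt_le_trans (cabs_ge_Re1 (ReG _ (cis1 t))); rewrite ltr_wpDr// ReG.
have dg z : cabs z <= 1 -> derivable (g : R[i]^o -> R[i]^o) z 1.
  by move=> z1; apply: cderivable_factor; [exact: dp|exact: dG|exact: ReG].
exists g; split => //.
  by move=> t; rewrite /g !cabsM !cabsV -invfM ler_pdivrMr ?mulr_gt0// -expr2 pG.
move=> s s0 s1; have wt := weak_type dG ReG G0 s0.
have cont (F : R[i] -> R[i]) : (forall z, cabs z <= 1 -> derivable (F : R[i]^o -> R[i]^o) z 1) ->
    measurable_fun setT (fun t => cabs (F (cis t))).
  move=> dF; apply: continuous_measurable_fun => t; apply: continuous_cabs_cis.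
  by apply: cderivable_continuous; exact: dF.
apply: le_trans (le_trans wt _).
  apply: le_measure; rewrite ?inE.
  - apply: measurable_superlevel => //; apply: measurable_funTS.
    apply: (cont (fun z => p z - g z)) => z z1.
    by apply: derivableB; [exact: dp|exact: dg].
  - by apply: measurable_superlevel => //; apply: measurable_funTS; exact: cont.
  move=> t [tI /= st]; split => //=; rewrite leNgt; apply/negP => Gs.
  move: st; apply/negP; rewrite -ltNge.
  have G0' := cabs_ge0 (G (cis t)).
  have n0 : 1 + G (cis t) != 0 by apply: factor_neq0; exact: ReG.
  have -> : p (cis t) - g (cis t) =
      p (cis t) * ((1 + G (cis t))^-1 * (1 + G (cis t))^-1) * (G (cis t) * (G (cis t) + 2)).
    by rewrite /g; field.
  have glam : cabs (p (cis t) * ((1 + G (cis t))^-1 * (1 + G (cis t))^-1)) <= lam.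
    by rewrite !cabsM !cabsV -invfM ler_pdivrMr ?mulr_gt0// -expr2 pG.
  have G2 : cabs (G (cis t) + 2) <= 3.
    apply: le_trans (cabsD _ _) _.
    have -> : cabs (2 : R[i]) = 2.
      have -> : (2 : R[i]) = Complex 2 0 by apply/eqP; rewrite eq_complex /= addr0 !eqxx.
      by rewrite cabs_real ger0_norm.
    lra.
  rewrite cabsM [cabs (_ * (G (cis t) + 2))]cabsM.
  apply: (@le_lt_trans _ _ (lam * (cabs (G (cis t)) * 3))).
    apply: ler_pM => //; rewrite ?cabs_ge0 ?mulr_ge0 ?cabs_ge0//.
    by rewrite ler_wpM2l.
  have := ltr_pM2l lam0 (cabs (G (cis t))) s; rewrite Gs => h; nra.
rewrite lee_fin ler_pM2r ?invr_gt0//; lra.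
Qed.

End Truncation.

(** * Radial limits *)

Section RadialLimit.
Variable R : realType.
Notation mu := (@lebesgue_measure R).

Lemma bounded_cvg_Rintegral (a b K : R) (u_ : nat -> R -> R) (u : R -> R) :
  (forall n, measurable_fun setT (u_ n)) -> measurable_fun setT u ->
  (forall n x, `|u_ n x| <= K) ->
  {ae mu, forall x, u_ n x @[n --> \oo] --> u x} ->
  \int[mu]_(x in `[a, b]) u_ n x @[n --> \oo] --> \int[mu]_(x in `[a, b]) u x.
Proof.
move=> mu_ mu_u uK cu.
have [|||||iu _ cvg_int] := @dominated_convergence _ _ R mu `[a, b]%classic (measurable_itv _)
  (fun n x => (u_ n x)%:E) (fun x => (u x)%:E) (fun=> K%:E).
- by move=> n; apply/measurable_EFinP; exact: (measurable_funTS (mu_ n)).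
- by apply/measurable_EFinP; exact: (measurable_funTS mu_u).
- case: cu => N [mN N0 sN]; exists N; split => //; apply: subset_trans sN => x /= nx cx.
  by apply: nx => _; apply: cvg_EFin; [exact: nearW|exact: cx].
- by have := @continuous_itv_integrable R (fun=> K) a b (fun x _ => @cst_continuous _ _ K x).
- by apply: aeW => x n _ /=; rewrite lee_fin.
apply: fine_cvg; rewrite [X in _ --> X](_ : _ = \int[mu]_(x in `[a, b]) (u x)%:E)%E//.
by rewrite /Rintegral fineK//; exact: integrable_fin_num iu.
Qed.

Lemma sqrt_excess_sqr (lam x : R) : 0 < lam -> 0 <= x -> sqrt_excess lam x ^+ 2 <= x / lam.
Proof.
move=> lam0 x0; have xl : 0 <= x / lam by rewrite divr_ge0// ltW.
rewrite -[leRHS](sqr_sqrtr xl) lerXn2r ?nnegrE ?sqrt_excess_ge0 ?sqrtr_ge0//.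
by rewrite /sqrt_excess ge_max sqrtr_ge0 /= lerBlDr lerDl.
Qed.

Lemma le_min_sqr (x K : R) : 0 <= x -> 0 < K -> x <= Num.min x K + x ^+ 2 / K.
Proof.
move=> x0 K0; have [xK|Kx] := leP x K; first by rewrite lerDl divr_ge0 ?sqr_ge0// ltW.
rewrite -lerBlDl ler_pdivlMr//; nra.
Qed.

Variables (F : R[i] -> R[i]) (phi : R -> R[i]) (M : R).
Hypothesis dF : forall z, cabs z < 1 -> derivable (F : R[i]^o -> R[i]^o) z 1.
Hypothesis mRe : measurable_fun setT (fun t => complex.Re (phi t)).
Hypothesis mIm : measurable_fun setT (fun t => complex.Im (phi t)).
Hypothesis radial : {ae mu, forall t,
  (F (Complex r 0 * cis t) : R[i]^o) @[r --> (1 : R)^'-] --> (phi t : R[i]^o)}.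
Hypothesis FM : forall r, 0 <= r -> r < 1 ->
  \int[mu]_(t in `[0, 2 * pi]) cabs (F (Complex r 0 * cis t)) <= M.

(** A sequence of radii tending to 1 from below, for use with convergence theorems on sequences of
    functions. *)
Definition inner_radius n : R := n.+1%:R / n.+2%:R.

Lemma inner_radius_ge0 n : 0 <= inner_radius n.
Proof. by rewrite divr_ge0. Qed.

Lemma inner_radius_lt1 n : inner_radius n < 1.
Proof. by rewrite ltr_pdivrMr// mul1r ltr_nat. Qed.

Lemma inner_radius_cvg : inner_radius n @[n --> \oo] --> (1 : R)^'-.
Proof.
have E n : inner_radius n = 1 - harmonic n.+1.
  by rewrite /inner_radius /harmonic /= -(natr1 n.+1); field; rewrite gt_eqF.
have cv : inner_radius n @[n --> \oo] --> (1 : R).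
  have h : (1 - harmonic n.+1 : R) @[n --> \oo] --> (1 - 0 : R).
    by apply: cvgB; [exact: cvg_cst|rewrite (cvg_shiftS (@harmonic R)); exact: cvg_harmonic].
  by rewrite subr0 in h; rewrite (funext E).
move=> A /nbhs_ballP[d /= d0 dA].
have := cv; move=> /cvgrPdist_lt /(_ d d0) [N _ HN]; exists N => // n Nn.
by apply: dA; [exact: HN|exact: inner_radius_lt1].
Qed.

Let psi n t := F (Complex (inner_radius n) 0 * cis t).

Lemma cderivable_dilation n z : cabs z <= 1 ->
  derivable ((fun z => F (Complex (inner_radius n) 0 * z)) : R[i]^o -> R[i]^o) z 1.
Proof.
move=> z1; apply: cderivable_scale; apply: dF.
by apply: cabs_scale_lt1; rewrite ?inner_radius_ge0// inner_radius_lt1.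
Qed.

Lemma psi_continuous n (w : R[i]) : continuous (fun t => cabs (psi n t - w)).
Proof.
move=> t; apply: (@continuous_cabs_cis _ (fun z => F (Complex (inner_radius n) 0 * z) - w)).
apply: cderivable_continuous; apply: derivableB; last exact: cderivable_cst.
by apply: cderivable_dilation; rewrite cabs_cis.
Qed.

Lemma psi_continuous_Re n : continuous (fun t => complex.Re (psi n t)).
Proof.
move=> t; apply: (@continuous_Re_cis _ (fun z => F (Complex (inner_radius n) 0 * z))).
by apply: cderivable_continuous; apply: cderivable_dilation; rewrite cabs_cis.
Qed.

Lemma psi_continuous_Im n : continuous (fun t => complex.Im (psi n t)).
Proof.
move=> t; apply: (@continuous_Im_cis _ (fun z => F (Complex (inner_radius n) 0 * z))).
by apply: cderivable_continuous; apply: cderivable_dilation; rewrite cabs_cis.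
Qed.

Lemma psi_cvg : {ae mu, forall t, (psi n t : R[i]^o) @[n --> \oo] --> (phi t : R[i]^o)}.
Proof.
case: radial => N [mN N0 sN]; exists N; split => //; apply: subset_trans sN => t /= nt ct.
by apply: nt; apply: (cvg_comp _ _ inner_radius_cvg ct).
Qed.

Lemma measurable_dist_phi (w : R[i]) : measurable_fun setT (fun t => cabs (phi t - w)).
Proof.
apply: measurable_cabs.
  by under eq_fun do rewrite raddfB; exact: measurable_funB.
by under eq_fun do rewrite raddfB; exact: measurable_funB.
Qed.

Lemma measurable_excess (g : R -> R) lam : measurable_fun setT g ->
  measurable_fun setT (fun t => sqrt_excess lam (g t)).
Proof.
move=> mg; apply: (measurableT_comp (f := sqrt_excess lam)) => //.
by apply: continuous_measurable_fun; exact: continuous_sqrt_excess.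
Qed.

(* By [x <= min x K + x ^ 2 / K], the [L^1] bound on the dilations makes the functions
   [sqrt_excess lam |psi n - w|] uniformly integrable, so bounded convergence applies. *)
Lemma excess_limit (w : R[i]) (lam e : R) : 0 < lam -> 0 < e ->
  mu.-integrable `[0, 2 * pi] (EFin \o (fun t => sqrt_excess lam (cabs (phi t - w)))) ->
  \forall n \near \oo,
    \int[mu]_(t in `[0, 2 * pi]) sqrt_excess lam (cabs (psi n t - w)) <=
    \int[mu]_(t in `[0, 2 * pi]) sqrt_excess lam (cabs (phi t - w)) + e.
Proof.
move=> lam0 e0 iphi; have pi2 : 0 < 2 * pi :> R by rewrite mulr_gt0// pi_gt0.
pose h n t := sqrt_excess lam (cabs (psi n t - w)).
pose h' t := sqrt_excess lam (cabs (phi t - w)).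
pose B := M + cabs w * (2 * pi).
have M0 : 0 <= M.
  by apply: le_trans (FM (lexx 0) ltr01); apply: Rintegral_ge0 => t _; exact: cabs_ge0.
have B0 : 0 <= B by rewrite addr_ge0// mulr_ge0 ?cabs_ge0 ?ltW.
(* [B] bounds the integral of [|psi n - w|], and truncation at [K] costs at most [B / (lam * K)],
   hence at most [e / 2]; the summand 1 keeps [K] positive when [B = 0]. *)
pose K := 2 * B / (lam * e) + 1.
have K0 : 0 < K by rewrite ltr_wpDl// divr_ge0 ?mulr_ge0// ltW// mulr_gt0.
have ch n : continuous (h n).
  move=> t; apply: (@continuous_comp _ _ _ (fun t => cabs (psi n t - w)) (sqrt_excess lam)).
    exact: psi_continuous.
  exact: continuous_sqrt_excess.
have mh n : measurable_fun setT (h n) by exact: continuous_measurable_fun.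
have mh' : measurable_fun setT h' by apply: measurable_excess; exact: measurable_dist_phi.
have cst_i k : mu.-integrable `[0, 2 * pi] (EFin \o (fun _ : R => k)).
  by apply: continuous_itv_integrable => x _; exact: cst_continuous.
have mmin (g : R -> R) : measurable_fun setT g -> measurable_fun setT (fun t => Num.min (g t) K).
  by move=> mg; apply: measurable_minr.
have minK (g : R -> R) t : (forall t, 0 <= g t) -> `|Num.min (g t) K| <= K.
  move=> g0; have m0 : 0 <= Num.min (g t) K by rewrite le_min g0 (ltW K0).
  by rewrite ger0_norm// ge_min lexx orbT.
have imin (g : R -> R) : measurable_fun setT g -> (forall t, 0 <= g t) ->
    mu.-integrable `[0, 2 * pi] (EFin \o (fun t => Num.min (g t) K)).
  move=> mg g0; apply: le_integrable (cst_i K) => //.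
    by apply/measurable_EFinP; apply: measurable_funTS; exact: mmin.
  by move=> t _ /=; rewrite lee_fin (le_trans (minK _ _ g0))// ger0_norm// ltW.
have cvgK : \int[mu]_(t in `[0, 2 * pi]) Num.min (h n t) K @[n --> \oo] -->
    \int[mu]_(t in `[0, 2 * pi]) Num.min (h' t) K.
  apply: (@bounded_cvg_Rintegral _ _ K (fun n t => Num.min (h n t) K) (fun t => Num.min (h' t) K)).
  - by move=> n; exact: mmin.
  - exact: mmin.
  - by move=> n t; apply: minK => ?; exact: sqrt_excess_ge0.
  - have [N [mN N0 sN]] := psi_cvg; exists N; split => //; apply: subset_trans sN => t /= nt ct.
    apply: nt.
    have c1 : h n t @[n --> \oo] --> h' t.
      apply: continuous_cvg; first exact: continuous_sqrt_excess.
      apply: (@cvg_cabs R nat \oo _ (fun n => psi n t - w) (phi t - w)).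
      by apply: (@cvgB _ R[i]^o _ _ _ _ (fun=> w) _ _ ct); exact: cvg_cst.
    by apply: (@continuous_cvg _ _ _ _ _ _ (fun x : R => Num.min x K) (h' t) _ c1);
      apply: (@continuous_min _ _ (fun x : R => x : R^o) (fun=> K : R^o));
      [exact: cvg_id|exact: cst_continuous].
have le' : \int[mu]_(t in `[0, 2 * pi]) Num.min (h' t) K <= \int[mu]_(t in `[0, 2 * pi]) h' t.
  apply: le_Rintegral => //; first by apply: imin => // t; exact: sqrt_excess_ge0.
  by move=> t _; rewrite -/(h' t) ge_min lexx.
have e2 : 0 < e / 2 by rewrite divr_gt0.
move/cvgrPdist_le : cvgK => /(_ _ e2); apply: filterS => n; rewrite ler_norml => /andP[near _].
have ipsi : mu.-integrable `[0, 2 * pi] (EFin \o (fun t => cabs (psi n t - w))).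
  by apply: continuous_itv_integrable => t _; exact: psi_continuous.
have ipsi0 : mu.-integrable `[0, 2 * pi] (EFin \o (fun t => cabs (psi n t))).
  by apply: continuous_itv_integrable => t _; have := @psi_continuous n 0 t;
    under eq_fun do rewrite subr0.
have psiB : \int[mu]_(t in `[0, 2 * pi]) cabs (psi n t - w) <= B.
  apply: (@le_trans _ _ (\int[mu]_(t in `[0, 2 * pi]) (cabs (psi n t) + cabs w))).
    apply: le_Rintegral => //.
      by have := integrableD _ ipsi0 (cst_i (cabs w)); apply.
    by move=> t _; exact: cabsB.
  rewrite RintegralD// Rintegral_itv_cst ?(ltW pi2)// subr0 lerD2r.
  by apply: FM; [exact: inner_radius_ge0|exact: inner_radius_lt1].
have ih : mu.-integrable `[0, 2 * pi] (EFin \o h n).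
  by apply: continuous_itv_integrable => t _; exact: ch.
pose k := (lam * K)^-1.
have iz : mu.-integrable `[0, 2 * pi] (EFin \o (fun t => k * cabs (psi n t - w))).
  by apply: continuous_itv_integrable => t _; apply: cvgMr; exact: psi_continuous.
have im := imin _ (mh n) (fun t => sqrt_excess_ge0 lam _).
have step : \int[mu]_(t in `[0, 2 * pi]) h n t <=
    \int[mu]_(t in `[0, 2 * pi]) Num.min (h n t) K + k * B.
  apply: (@le_trans _ _ (\int[mu]_(t in `[0, 2 * pi]) (Num.min (h n t) K + k * cabs (psi n t - w)))).
    apply: le_Rintegral => //.
      by have := integrableD _ im iz; apply.
    move=> t _; apply: le_trans (le_min_sqr (sqrt_excess_ge0 _ _) K0) _.
    have sq := sqrt_excess_sqr lam0 (cabs_ge0 (psi n t - w)).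
    rewrite lerD2l; apply: (@le_trans _ _ (cabs (psi n t - w) / lam / K)).
      by rewrite ler_pM2r ?invr_gt0.
    by rewrite /k -mulrA -invfM mulrC.
  rewrite RintegralD// lerD2l RintegralZl// ler_wpM2l// /k invr_ge0 mulr_ge0// ltW//.
have kB : k * B <= e / 2.
  rewrite /k mulrC ler_pdivrMr ?mulr_gt0// /K.
  have -> : e / 2 * (lam * (2 * B / (lam * e) + 1)) = B + e / 2 * lam.
    by field; rewrite !gt_eqF.
  by rewrite lerDl mulr_ge0// ltW.
apply: (le_trans step).
apply: (@le_trans _ _ (\int[mu]_(t in `[0, 2 * pi]) Num.min (h' t) K + e / 2 + e / 2)).
  by rewrite lerD// -lerBlDl -opprB lerNl.
by rewrite -addrA -splitr lerD2r.
Qed.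

(** Convergence almost everywhere gives convergence in measure on a bounded interval: the distance
    cut at [e] converges boundedly to 0, and Chebyshev's inequality applies at level [e]. *)
Lemma measure_limit (e d : R) : 0 < e -> 0 < d ->
  \forall n \near \oo,
   (mu (`[0%R, (2 * pi)%R] `&` [set t | (e <= cabs (phi t - psi n t))%R]) <= d%:E)%E.
Proof.
move=> e0 d0.
pose h n t := Num.min (cabs (phi t - psi n t)) e.
have mpsi n : measurable_fun setT (fun t => cabs (phi t - psi n t)).
  apply: measurable_cabs.
    under eq_fun do rewrite raddfB; apply: measurable_funB => //.
    by apply: continuous_measurable_fun => t; apply: psi_continuous_Re.
  under eq_fun do rewrite raddfB; apply: measurable_funB => //.
  by apply: continuous_measurable_fun => t; apply: psi_continuous_Im.
have mh n : measurable_fun setT (h n).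
  by apply: measurable_minr.
have h0 n t : 0 <= h n t by rewrite le_min cabs_ge0 (ltW e0).
have : \int[mu]_(t in `[0, 2 * pi]) h n t @[n --> \oo] --> \int[mu]_(t in `[0, 2 * pi]) 0.
  apply: (@bounded_cvg_Rintegral _ _ e h (fun=> 0)) => //.
    by move=> n t; rewrite ger0_norm// ge_min lexx orbT.
  have [N [mN N0 sN]] := psi_cvg; exists N; split => //; apply: subset_trans sN => t /= nt ct.
  apply: nt.
  have c1 : cabs (phi t - psi n t) @[n --> \oo] --> (0 : R).
    rewrite -(@cabs0 R) -(subrr (phi t)).
    apply: (@cvg_cabs R nat \oo _ (fun n => phi t - psi n t) (phi t - phi t)).
    by apply: (@cvgB _ R[i]^o _ _ _ (fun=> phi t) _ _ _ _ ct); exact: cvg_cst.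
  apply: (@squeeze_cvgr _ _ _ _ (fun=> 0) (fun n => cabs (phi t - psi n t))) => //.
    by apply: nearW => n; rewrite h0 ge_min lexx.
  exact: cvg_cst.
have z : \int[mu]_(t in `[0, 2 * pi]) (0 : R) = 0.
  by rewrite Rintegral_cst// mul0r.
rewrite z => /cvgrPdist_le; have ed : 0 < e * d by rewrite mulr_gt0.
move=> /(_ _ ed); apply: filterS => n; rewrite sub0r normrN => Hn.
have I0 := le_trans (ler_norm _) Hn.
have ih : mu.-integrable `[0, 2 * pi] (EFin \o h n).
  have ce : mu.-integrable `[0, 2 * pi] (EFin \o (fun _ : R => e)).
    by apply: continuous_itv_integrable => x _; exact: cst_continuous.
  apply: le_integrable ce => //.
    by apply/measurable_EFinP; apply: measurable_funTS; exact: mh.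
  by move=> t _ /=; rewrite lee_fin !ger0_norm ?h0 ?(ltW e0)// ge_min lexx orbT.
have := @chebyshev_superlevel R `[0, 2 * pi] (h n) e (measurable_itv _)
  (measurable_funTS (mh n)) e0 (fun t _ => h0 n t).
have fin : (\int[mu]_(t in `[0%R, (2 * pi)%R]) (h n t)%:E = (\int[mu]_(t in `[0, 2 * pi]) h n t)%:E)%E.
  by rewrite /Rintegral fineK//; exact: integrable_fin_num ih.
rewrite fin => H.
have E : `[0, 2 * pi] `&` [set t | e <= cabs (phi t - psi n t)] =
    `[0, 2 * pi] `&` [set t | e <= h n t].
  by apply/seteqP; split => t [tI /= he]; split => //=; move: he; rewrite /h le_min lexx andbT.
rewrite E -(@lee_pmul2l _ e%:E)//.
by apply: le_trans H _; rewrite -EFinM lee_fin.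
Qed.

End RadialLimit.

(** * Estimates for a normalized BMOA function *)

Section Final.
Variable R : realType.
Notation mu := (@lebesgue_measure R).
Implicit Types (lam eps t : R).

(** The largest [c] with [exp (8 c) <= 3 / 2]. *)
Definition jn_exponent : R := ln (3 / 2) / 8.

Lemma jn_exponent_gt0 : 0 < jn_exponent.
Proof. by rewrite divr_gt0// ln_gt0//; lra. Qed.

Lemma expR_jn_exponent : expR (jn_exponent * 8) <= 3 / 2.
Proof. by rewrite /jn_exponent divfK// lnK// posrE; lra. Qed.

Lemma sqrt_excess_le lam (x : R) : 0 < lam -> 0 <= x -> sqrt_excess lam x <= x / lam.
Proof.
move=> lam0 x0; have y0 : 0 <= x / lam by rewrite divr_ge0// ltW.
rewrite /sqrt_excess ge_max y0 /= lerBlDr.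
have s0 := sqrtr_ge0 (x / lam); rewrite -{2}(sqr_sqrtr y0); nra.
Qed.

(** Where the excess is positive it is at most [x / lam - 1], and
    [c * (x - lam) <= exp (c * (x - lam))]. *)
Lemma sqrt_excess_exp (c lam x : R) : 0 < c -> 0 < lam -> 0 <= x ->
  sqrt_excess lam x <= expR (c * x) * (expR (- (c * lam)) / (c * lam)).
Proof.
move=> c0 lam0 x0; have y0 : 0 <= x / lam by rewrite divr_ge0// ltW.
have cl : 0 < c * lam by rewrite mulr_gt0.
rewrite mulrA -expRD /sqrt_excess ge_max divr_ge0 ?expR_ge0 ?(ltW cl)//=.
have [s1|s1] := leP (Num.sqrt (x / lam)) 1.
  by apply: (@le_trans _ _ 0); [rewrite subr_le0|rewrite divr_ge0 ?expR_ge0 ?(ltW cl)].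
apply: (@le_trans _ _ (x / lam - 1)).
  by rewrite lerD2r -{2}(sqr_sqrtr y0); nra.
rewrite ler_pdivlMr//; have -> : (x / lam - 1) * (c * lam) = c * x - c * lam.
  by field; rewrite gt_eqF.
by apply: le_trans (expR_ge1Dx _); rewrite lerDr.
Qed.

Section Normalized.
Variable f : R[i] -> R[i].
Hypothesis fB : BMOA f.
Hypothesis f1 : (BMOA_norm f <= 1%:E)%E.

Let F := analytic_extension f.
Let phi t := f (cis t).
Let m := arc_mean f 0 (2 * pi).
Let c := jn_exponent.

Lemma pi2_gt0 : 0 < 2 * pi :> R.
Proof. by rewrite mulr_gt0// pi_gt0. Qed.

Lemma extensionP : hardy1 F /\ boundary_value F f.
Proof.
case: fB => -[F0 h b] _; rewrite /F /analytic_extension.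
by case: xgetP => [y -> //|/(_ F0)]; case.
Qed.

Lemma bmo_seminorm_ge0 : (0 <= bmo_seminorm f)%E.
Proof.
apply: (@le_trans _ _ (mean_oscillation f 0 (2 * pi))); last first.
  by apply: ereal_sup_ubound; exists (0, 2 * pi) => //=; rewrite pi2_gt0 add0r lexx.
rewrite mule_ge0// ?lee_fin ?subr0 ?invr_ge0 ?(ltW pi2_gt0)//.
by apply: integral_ge0 => t _; rewrite lee_fin cabs_ge0.
Qed.

Lemma mean_oscillation_le1 (a b : R) : a < b -> b <= a + 2 * pi ->
  (mean_oscillation f a b <= 1)%E.
Proof.
move=> ab bpi; apply: le_trans f1; apply: (@le_trans _ _ (bmo_seminorm f)).
  by apply: ereal_sup_ubound; exists (a, b) => //=; rewrite ab bpi.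
by rewrite /BMOA_norm leeDr// lee_fin cabs_ge0.
Qed.

Lemma extension0_le1 : cabs (F 0) <= 1.
Proof.
rewrite -lee_fin; apply: le_trans f1; rewrite /BMOA_norm leeDl//.
exact: bmo_seminorm_ge0.
Qed.

Let mRe : measurable_fun setT (fun t => complex.Re (phi t)).
Proof. by have [_ []] := extensionP. Qed.

Let mIm : measurable_fun setT (fun t => complex.Im (phi t)).
Proof. by have [_ []] := extensionP. Qed.

Let radial : {ae mu, forall t,
  (F (Complex r 0 * cis t) : R[i]^o) @[r --> (1 : R)^'-] --> (phi t : R[i]^o)}.
Proof. by have [_ []] := extensionP. Qed.

Let dF z : cabs z < 1 -> derivable (F : R[i]^o -> R[i]^o) z 1.
Proof. by have [[h _] _] := extensionP; exact: h. Qed.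

Lemma hardy1_bound : exists M : R, forall r, 0 <= r -> r < 1 ->
  \int[mu]_(t in `[0, 2 * pi]) cabs (F (Complex r 0 * cis t)) <= M.
Proof.
have [[_ +] _] := extensionP; set S := ereal_sup _ => Sfin.
have I0 r : (0 <= \int[mu]_(t in `[0%R, (2 * pi)%R]) (cabs (F (Complex r 0 * cis t)))%:E)%E.
  by apply: integral_ge0 => t _; rewrite lee_fin cabs_ge0.
have Sr r : 0 <= r -> r < 1 -> (((2 * pi)^-1)%:E *
    \int[mu]_(t in `[0%R, (2 * pi)%R]) (cabs (F (Complex r 0 * cis t)))%:E <= S)%E.
  by move=> r0 r1; apply: ereal_sup_ubound; exists r => //=; rewrite in_itv /= r0.
have S0 : (0 <= S)%E.
  apply: le_trans (Sr 0 (lexx _) ltr01).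
  by rewrite mule_ge0// lee_fin invr_ge0 ltW// pi2_gt0.
exists (2 * pi * fine S) => r r0 r1; rewrite /Rintegral.
have := Sr r r0 r1; rewrite lee_pdivrMl ?pi2_gt0// => H.
have E : (((2 * pi)%:E * S) = (2 * pi * fine S)%:E)%E.
  have Sf : S \is a fin_num by rewrite ge0_fin_numE.
  by rewrite -{1}(fineK Sf) -EFinM.
rewrite E in H; rewrite -lee_fin fineK// ge0_fin_numE//.
by apply: le_lt_trans H _; rewrite ltry.
Qed.

Lemma phi_dist_integrable w : mu.-integrable `[0, 2 * pi] (EFin \o (fun t => cabs (phi t - w))).
Proof.
apply: (@integrable_dist _ f mRe mIm mean_oscillation_le1); first exact: pi2_gt0.
by rewrite add0r.
Qed.

Lemma phi_excess_integrable lam w : 0 < lam ->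
  mu.-integrable `[0, 2 * pi] (EFin \o (fun t => sqrt_excess lam (cabs (phi t - w)))).
Proof.
move=> lam0.
have iz : mu.-integrable `[0, 2 * pi] (EFin \o (fun t => lam^-1 * cabs (phi t - w))).
  by have := integrableZl _ lam^-1 (phi_dist_integrable w); apply.
apply: le_integrable iz => //.
  apply/measurable_EFinP; apply: measurable_funTS; apply: measurable_excess.
  exact: (measurable_dist_phi mRe mIm w).
move=> t _ /=; rewrite lee_fin !ger0_norm ?sqrt_excess_ge0//.
  by rewrite mulrC sqrt_excess_le// cabs_ge0.
by rewrite mulr_ge0 ?cabs_ge0// invr_ge0 ltW.
Qed.

(** For a dilation of [F - m] the mean of the excess at [lam = 1] is at most 2: 1 from the
    oscillation of [f] and 1 from the tolerance in the limit. So [|F 0 - m|] is at most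
    [(2 + 2) ^+ 2 = 16], and [|F 0| <= 1]. *)
Lemma mean_le : cabs m <= 17.
Proof.
have [M FM] := hardy1_bound.
have [N _ HN] := @excess_limit R F phi M dF mRe mIm radial FM m 1 (2 * pi) ltr01 pi2_gt0
  (phi_excess_integrable m ltr01).
have {HN}H := HN N (leqnn N).
pose p (z : R[i]) := F (Complex (inner_radius R N) 0 * z) - m.
have dp z : cabs z <= 1 -> derivable (p : R[i]^o -> R[i]^o) z 1.
  move=> z1; apply: (@cderivableD _ (fun z => F (Complex (inner_radius R N) 0 * z)) (fun=> - m)).
    exact: (cderivable_dilation dF z1).
  exact: cderivable_cst.
have := submean dp; rewrite {1}/p mulr0 => sub.
have I1 : \int[mu]_(t in `[0, 2 * pi]) sqrt_excess 1 (cabs (phi t - m)) <= 2 * pi.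
  apply: (@le_trans _ _ (\int[mu]_(t in `[0, 2 * pi]) cabs (phi t - m))).
    apply: le_Rintegral => //.
    - exact: phi_excess_integrable.
    - exact: phi_dist_integrable.
    - by move=> t _; rewrite -[leRHS]divr1 sqrt_excess_le// cabs_ge0.
  have := @osc_mean _ f mRe mIm mean_oscillation_le1 0 (2 * pi) pi2_gt0.
  by rewrite add0r subr0; exact.
have I2 : \int[mu]_(t in `[0, 2 * pi]) sqrt_excess 1 (cabs (p (cis t))) <= 2 * (2 * pi).
  by apply: le_trans H _; lra.
have A2 : (2 * pi)^-1 * \int[mu]_(t in `[0, 2 * pi]) sqrt_excess 1 (cabs (p (cis t))) <= 2.
  by rewrite mulrC ler_pdivrMr ?pi2_gt0.
have A0 : 0 <= (2 * pi)^-1 * \int[mu]_(t in `[0, 2 * pi]) sqrt_excess 1 (cabs (p (cis t))).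
  rewrite mulr_ge0 ?invr_ge0 ?(ltW pi2_gt0)//.
  by apply: Rintegral_ge0 => t _; exact: sqrt_excess_ge0.
have F16 : cabs (F 0 - m) <= 16.
  apply: (le_trans sub); move: A2 A0; set A := _ * Rintegral _ _ _ => A2 A0; nra.
rewrite (_ : m = F 0 - (F 0 - m)); last by ring.
apply: le_trans (cabsB _ _) _; have := extension0_le1; lra.
Qed.

(** The bound [3 * (2 * pi)] for the exponential moment of [f - m], times the cost of
    [|m| <= 17]. *)
Definition jn_bound : R := expR (c * 17) * (6 * pi).

Lemma measurable_cabs_phi : measurable_fun setT (fun t => cabs (phi t)).
Proof. exact: measurable_cabs. Qed.

Lemma measurable_exp_phi : measurable_fun setT (fun t => expR (c * cabs (phi t))).
Proof.
apply: (measurableT_comp (f := expR)) => //.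
by apply: measurable_funM; [exact: measurable_cst|exact: measurable_cabs_phi].
Qed.

Lemma exp_moment :
  (\int[mu]_(t in `[0%R, (2 * pi)%R]) (expR (c * cabs (phi t)))%:E <= jn_bound%:E)%E.
Proof.
have c0 : 0 <= c := ltW jn_exponent_gt0.
have mexp : measurable_fun setT (fun t => expR (c * cabs (phi t - m))).
  apply: (measurableT_comp (f := expR)) => //.
  by apply: measurable_funM; [exact: measurable_cst|exact: (measurable_dist_phi mRe mIm)].
rewrite -integral_itv_bndo_bndc; last first.
  by apply/measurable_EFinP; apply: measurable_funTS; exact: measurable_exp_phi.
have := @john_nirenberg _ f mRe mIm mean_oscillation_le1 c c0 expR_jn_exponent 0 (2 * pi) pi2_gt0.
rewrite add0r lexx subr0 => /(_ isT) jn.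
apply: (@le_trans _ _ ((expR (c * 17))%:E *
  \int[mu]_(t in `[0%R, (2 * pi)%R[) (expR (c * cabs (phi t - m)))%:E)%E).
  rewrite -ge0_integralZl//=.
  - apply: ge0_le_integral => //=.
    + by apply/measurable_EFinP; apply: measurable_funTS; exact: measurable_exp_phi.
    + apply/measurable_EFinP; apply: measurable_funTS.
      by apply: measurable_funM => //; exact: measurable_cst.
    + move=> t _; rewrite -EFinM lee_fin -expRD ler_expR -mulrDr ler_wpM2l//.
      rewrite {1}(_ : phi t = m + (phi t - m)); last by ring.
      by apply: le_trans (cabsD _ _) _; rewrite lerD2r mean_le.
  - by apply/measurable_EFinP; apply: measurable_funTS.
rewrite /jn_bound EFinM lee_pmul2l ?lte_fin ?expR_gt0//.
by apply: (le_trans jn); rewrite lee_fin; lra.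
Qed.

Lemma excess_bound lam : 0 < lam ->
  \int[mu]_(t in `[0, 2 * pi]) sqrt_excess lam (cabs (phi t)) <=
  jn_bound * (expR (- (c * lam)) / (c * lam)).
Proof.
move=> lam0; have c0 := jn_exponent_gt0.
have iexp : mu.-integrable `[0, 2 * pi] (EFin \o (fun t => expR (c * cabs (phi t)))).
  apply/integrableP; split.
    by apply/measurable_EFinP; apply: measurable_funTS; exact: measurable_exp_phi.
  under eq_integral do rewrite /= ger0_norm ?expR_ge0//.
  by apply: le_lt_trans exp_moment _; rewrite ltry.
have iex : mu.-integrable `[0, 2 * pi] (EFin \o (fun t => sqrt_excess lam (cabs (phi t)))).
  have := phi_excess_integrable 0 lam0.
  by rewrite (_ : (fun t => sqrt_excess lam (cabs (phi t - 0))) =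
    (fun t => sqrt_excess lam (cabs (phi t))))//; apply/funext => t; rewrite subr0.
set k := expR _ / _; have k0 : 0 <= k by rewrite divr_ge0 ?expR_ge0// mulr_ge0 ?ltW.
have iek : mu.-integrable `[0, 2 * pi] (EFin \o (fun t => expR (c * cabs (phi t)) * k)).
  by have := integrableZr _ k iexp; apply.
apply: (@le_trans _ _ (\int[mu]_(t in `[0, 2 * pi]) (expR (c * cabs (phi t)) * k))).
  by apply: le_Rintegral => // t _; apply: sqrt_excess_exp => //; exact: cabs_ge0.
rewrite RintegralZr// ler_wpM2r//.
rewrite -lee_fin /Rintegral fineK ?exp_moment//; exact: integrable_fin_num iexp.
Qed.

Lemma tail_bound eps : 0 < eps ->
  (mu (`[0%R, (2 * pi)%R] `&` [set t | (eps <= cabs (phi t))%R]) <=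
   (jn_bound * expR (- (c * eps)))%:E)%E.
Proof.
move=> eps0; have c0 := jn_exponent_gt0.
have := @chebyshev_superlevel R `[0, 2 * pi] (fun t => expR (c * cabs (phi t)))
  (expR (c * eps)) (measurable_itv _) (measurable_funTS measurable_exp_phi)
  (expR_gt0 _) (fun t _ => expR_ge0 _).
move=> /le_trans /(_ exp_moment).
have -> : [set x | expR (c * eps) <= expR (c * cabs (phi x))] = [set t | eps <= cabs (phi t)].
  by apply/seteqP; split => x /=; rewrite ler_expR ler_pM2l.
move=> H; rewrite expRN -(@lee_pmul2l _ (expR (c * eps))%:E)// ?lte_fin ?expR_gt0//.
by rewrite -EFinM mulrCA divff ?mulr1// gt_eqF// expR_gt0.
Qed.

End Normalized.
End Final.

(** * The approximation theorem *)

Section Circle.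
Variable R : realType.
Notation mu := (@lebesgue_measure R).

Lemma Hinfty_closed_disk (g : R[i] -> R[i]) :
  (forall z, cabs z <= 1 -> derivable (g : R[i]^o -> R[i]^o) z 1) -> Hinfty g.
Proof.
move=> dg; have cg z : cabs z <= 1 -> {for z, continuous (g : R[i]^o -> R[i]^o)}.
  by move=> /dg /cderivable_continuous.
exists g; split.
- by move=> z z1; apply: dg; exact: ltW.
- have [M HM] := closed_disk_bounded cg.
  by exists M => z z1; apply: HM; exact: ltW.
- apply: continuous_measurable_fun => t; apply: continuous_Re_cis.
  by apply: cg; rewrite cabs_cis.
- apply: continuous_measurable_fun => t; apply: continuous_Im_cis.
  by apply: cg; rewrite cabs_cis.
- apply: aeW => t; have ct : {for cis t, continuous (g : R[i]^o -> R[i]^o)}.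
    by apply: cg; rewrite cabs_cis.
  have lim : (Complex r 0 * cis t : R[i]^o) @[r --> (1 : R)^'-] --> (cis t : R[i]^o).
    have cm : {for 1, continuous ((fun z => z * cis t) : R[i]^o -> R[i]^o)}.
      apply: cderivable_continuous; apply: cderivableM; last exact: cderivable_cst.
      exact: derivable_id.
    have c1 : (Complex r 0 : R[i]^o) @[r --> (1 : R)^'-] --> (1 : R[i]^o).
      apply: cvg_at_left_filter.
      apply: (@cvg_complexP _ _ (nbhs (1 : R)) _ (fun r => Complex r 0) 1).2.
      by split; [exact: cvg_id|exact: (@cvg_cst _ (0 : R))].
    have := cvg_comp _ _ c1 cm; rewrite mul1r; exact.
  exact: cvg_comp lim ct.
Qed.

Lemma Hinfty_norm_le (g : R[i] -> R[i]) (lam : R) :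
  (forall t, cabs (g (cis t)) <= lam) -> (Hinfty_norm g <= lam%:E)%E.
Proof.
by move=> gl; apply/ess_supP; apply: aeW => t; rewrite lee_fin.
Qed.

Definition close_set (f g : R[i] -> R[i]) (eps : R) : set R[i] :=
  [set z | cabs z = 1 /\ cabs (f z - g z) <= eps].

Lemma close_set_measurable (f g : R[i] -> R[i]) (eps : R) :
  measurable_fun setT (fun t => cabs (f (cis t) - g (cis t))) ->
  circle_measurable (close_set f g eps).
Proof.
move=> mfg; split; first by move=> z [].
have -> : [set t | close_set f g eps (cis t)] =
    setT `&` (fun t => cabs (f (cis t) - g (cis t))) @^-1` `]-oo, eps].
  apply/seteqP; split => t; rewrite /close_set /= in_itv /=.
    by case.
  by case=> _ h; split => //; exact: cabs_cis.
by apply: mfg => //; exact: measurable_itv.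
Qed.

Lemma arc_length_far (f g : R[i] -> R[i]) (eps : R) :
  measurable_fun setT (fun t => cabs (f (cis t) - g (cis t))) ->
  (arc_length (@circle R `\` close_set f g eps) <=
   mu (`[0%R, (2 * pi)%R] `&` [set t | (eps <= cabs (f (cis t) - g (cis t)))%R]))%E.
Proof.
move=> mfg; have [_ mC] := close_set_measurable eps mfg.
apply: le_measure; rewrite ?inE.
- apply: measurableI; first exact: measurable_itv.
  have -> : [set t | (@circle R `\` close_set f g eps) (cis t)] = ~` [set t | close_set f g eps (cis t)].
    by apply/seteqP; split => t /=; [case|split => //; exact: cabs_cis].
  exact: measurableC.
- by apply: measurable_superlevel => //; exact: measurable_funTS.
- move=> t [+ /= [_ far]]; rewrite /= !in_itv /= => /andP[-> /ltW ->]; split => //=.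
  rewrite leNgt; apply/negP => h; apply: far; split; first exact: cabs_cis.
  exact: ltW.
Qed.

End Circle.

Theorem lemma2 (R : realType) :
  exists c1 c2 : R, 0 < c1 /\ 0 < c2 /\
    forall f : R[i] -> R[i], BMOA f -> (BMOA_norm f <= 1%:E)%E ->
    forall eps lambda : R, 0 < eps -> 0 < lambda ->
    exists (g : R[i] -> R[i]) (E : set R[i]),
      Hinfty g /\ circle_measurable E /\
      (Hinfty_norm g <= lambda%:E)%E /\
      (forall theta : R[i], E theta -> cabs (f theta - g theta) <= eps) /\
      (arc_length (@circle R `\` E)
        <= (eps^-1 * expR (- (lambda * c1)) * c2)%:E)%E.
Proof.
pose c := jn_exponent R; pose Q := jn_bound R.
have c0 : 0 < c := jn_exponent_gt0 R.
have Q0 : 0 < Q by rewrite mulr_gt0 ?expR_gt0// mulr_gt0// pi_gt0.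
(* The last summand serves the case [6 * lam < eps], the others the opposite case. *)
exists c, (24 * (Q / c + 2) + 1 + 2 * Q / c).
have Qc : 0 < Q / c by rewrite divr_gt0.
split => //; split.
  have : 0 < 2 * Q / c by rewrite divr_gt0// mulr_gt0.
  lra.
move=> f fB f1 eps lam eps0 lam0.
have [[[dF _] [mRe mIm radial]]] := (extensionP fB, tt).
have [M FM] := hardy1_bound fB.
have eps_inv : 0 < eps^-1 by rewrite invr_gt0.
have explam : 0 < expR (- (c * lam)) := expR_gt0 _.
have [epslam|epslam] := ltP (6 * lam) eps.
  pose g (z : R[i]) : R[i] := 0.
  have mfg : measurable_fun setT (fun t : R => cabs (f (cis t) - g (cis t))).
    by under eq_fun do rewrite subr0; exact: measurable_cabs.
  exists g, (close_set f g eps); split; last split; last split; last split.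
  - by apply: Hinfty_closed_disk => z _; exact: cderivable_cst.
  - exact: close_set_measurable.
  - by apply: Hinfty_norm_le => t; rewrite cabs0 ltW.
  - by move=> z [].
  apply: (le_trans (arc_length_far eps mfg)).
  have -> : [set t | eps <= cabs (f (cis t) - g (cis t))] = [set t | eps <= cabs (f (cis t))].
    by apply/seteqP; split => t /=; rewrite subr0.
  apply: (le_trans (tail_bound fB f1 eps0)); rewrite lee_fin -/c -/Q.
  (* Half of the exponent yields [1 / eps], by [exp (- y) <= 1 / y]; the other half yields the decay
     in [lam], since [eps / 2 > 3 * lam]. *)
  have y0 : 0 < c * eps / 2 by rewrite divr_gt0// mulr_gt0.
  have e1 : expR (- (c * eps / 2)) <= (c * eps / 2)^-1.
    rewrite expRN lef_pV2 ?posrE ?expR_gt0//.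
    by apply: le_trans (expR_ge1Dx _); rewrite lerDr.
  have e2 : expR (- (c * eps / 2)) <= expR (- (c * lam)).
    by rewrite ler_expR lerN2 -mulrA ler_pM2l//; lra.
  have -> : - (c * eps) = - (c * eps / 2) + - (c * eps / 2) by lra.
  rewrite expRD; apply: (@le_trans _ _ (Q * ((c * eps / 2)^-1 * expR (- (c * lam))))).
    by rewrite ler_pM2l// ler_pM ?expR_ge0.
  have -> : Q * ((c * eps / 2)^-1 * expR (- (c * lam))) =
      eps^-1 * expR (- (lam * c)) * (2 * Q / c).
    by rewrite (mulrC lam); field; rewrite !gt_eqF.
  by rewrite ler_pM2l ?mulr_gt0 ?expR_gt0//; lra.
set e := expR (- (c * lam)) in explam.
(* A tolerance of the order of the excess bound itself, so that it only affects the constant. *)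
pose d := e / lam.
have d0 : 0 < d by rewrite divr_gt0.
have d1 : 0 < eps^-1 * e by rewrite mulr_gt0.
have eps2 : 0 < eps / 2 by rewrite divr_gt0.
have iex := phi_excess_integrable fB f1 0 lam0.
have L1 := excess_limit dF mRe mIm radial FM lam0 d0 iex.
have L2 := measure_limit dF mRe mIm radial eps2 d1.
have [n [Hn1 Hn2]] := filter_ex (filterI L1 L2).
have [g [dg glam wg]] := analytic_truncation lam0 d0 (@cderivable_dilation _ _ dF n).
have cts (F : R[i] -> R[i]) t : (forall z, cabs z <= 1 -> derivable (F : R[i]^o -> R[i]^o) z 1) ->
    {for cis t, continuous (F : R[i]^o -> R[i]^o)}.
  by move=> h; apply: cderivable_continuous; apply: h; rewrite cabs_cis.
have mdist (F : R[i] -> R[i]) : (forall z, cabs z <= 1 -> derivable (F : R[i]^o -> R[i]^o) z 1) ->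
    measurable_fun setT (fun t : R => cabs (f (cis t) - F (cis t))).
  move=> h; apply: measurable_cabs.
    under eq_fun do rewrite raddfB; apply: measurable_funB => //.
    by apply: continuous_measurable_fun => t; apply: continuous_Re_cis; exact: cts.
  under eq_fun do rewrite raddfB; apply: measurable_funB => //.
  by apply: continuous_measurable_fun => t; apply: continuous_Im_cis; exact: cts.
have mfg := mdist g dg.
exists g, (close_set f g eps); split; last split; last split; last split.
- exact: Hinfty_closed_disk.
- exact: close_set_measurable.
- exact: Hinfty_norm_le.
- by move=> z [].
apply: (le_trans (arc_length_far eps mfg)).
pose p (z : R[i]) := analytic_extension f (Complex (inner_radius R n) 0 * z).
(* With this level [g] is within [eps / 2] of the dilation [p] off a small set; the other half of
   [eps] is left for the distance from [f] to [p]. *)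
pose s := eps / (6 * lam).
have s0 : 0 < s by rewrite divr_gt0// mulr_gt0.
have s1 : s <= 1 by rewrite ler_pdivrMr ?mulr_gt0// mul1r.
have se : 3 * lam * s = eps / 2 by rewrite /s; field; rewrite gt_eqF.
have := wg s s0 s1; rewrite se => {}wg.
have sub : `[0, 2 * pi] `&` [set t | eps <= cabs (f (cis t) - g (cis t))] `<=`
   (`[0, 2 * pi] `&` [set t | eps / 2 <= cabs (f (cis t) - p (cis t))]) `|`
   (`[0, 2 * pi] `&` [set t | eps / 2 <= cabs (p (cis t) - g (cis t))]).
  move=> t [tI /= te]; have [h|h] := leP (eps / 2) (cabs (f (cis t) - p (cis t))); [by left|right].
  split => //=; rewrite leNgt; apply/negP => h'.
  move: te; apply/negP; rewrite -ltNge.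
  rewrite (_ : f (cis t) - g (cis t) = (f (cis t) - p (cis t)) + (p (cis t) - g (cis t))); last by ring.
  by apply: le_lt_trans (cabsD _ _) _; rewrite (splitr eps) ltrD.
have dp : forall z, cabs z <= 1 -> derivable (p : R[i]^o -> R[i]^o) z 1.
  exact: (@cderivable_dilation _ _ dF n).
have mA : measurable (`[0, 2 * pi] `&` [set t : R | eps / 2 <= cabs (f (cis t) - p (cis t))]).
  by apply: measurable_superlevel => //; apply: measurable_funTS; exact: mdist.
have mB : measurable (`[0, 2 * pi] `&` [set t : R | eps / 2 <= cabs (p (cis t) - g (cis t))]).
  apply: measurable_superlevel => //; apply: measurable_funTS.
  apply: continuous_measurable_fun => t; apply: (@continuous_cabs_cis _ (fun z => p z - g z)).
  have t1 : cabs (cis t : R[i]) <= 1 by rewrite cabs_cis.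
  by apply: cderivable_continuous; have := derivableB (dp _ t1) (dg _ t1); exact.
have mC : measurable (`[0, 2 * pi] `&` [set t : R | eps <= cabs (f (cis t) - g (cis t))]).
  by apply: measurable_superlevel => //; apply: measurable_funTS.
apply: (@le_trans _ _ (lebesgue_measure
   ((`[0, 2 * pi] `&` [set t : R | eps / 2 <= cabs (f (cis t) - p (cis t))]) `|`
   (`[0, 2 * pi] `&` [set t : R | eps / 2 <= cabs (p (cis t) - g (cis t))])))).
  by apply: le_measure; rewrite ?inE//; exact: measurableU.
have U2 := @measureU2 _ _ R (@lebesgue_measure R) _ _ mA mB.
apply: (le_trans U2).
apply: (le_trans (leeD Hn2 wg)); rewrite -EFinD lee_fin.
have Hex := excess_bound fB f1 lam0.
have I1 : \int[lebesgue_measure]_(t in `[0, 2 * pi]) sqrt_excess lam (cabs (p (cis t))) <=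
    Q * (e / (c * lam)) + d.
  have E (h : R -> R[i]) : \int[lebesgue_measure]_(t in `[0, 2 * pi]) sqrt_excess lam (cabs (h t)) =
      \int[lebesgue_measure]_(t in `[0, 2 * pi]) sqrt_excess lam (cabs (h t - 0)).
    by apply: eq_Rintegral => t _; rewrite subr0.
  rewrite E; apply: (le_trans Hn1); rewrite lerD2r -E; exact: Hex.
rewrite (mulrC lam) -/e.
apply: (@le_trans _ _ (eps^-1 * e + 4 * (Q * (e / (c * lam)) + d + d) / s)).
  by rewrite lerD2l ler_pM2r ?invr_gt0// ler_pM2l// lerD2r.
(* One [d] comes from the limit of the dilations, the other from the construction of [G]; the factor
   24 is 4 times the 6 in [s]. *)
have -> : eps^-1 * e + 4 * (Q * (e / (c * lam)) + d + d) / s =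
   eps^-1 * e * (24 * (Q / c + 2) + 1).
  by rewrite /s /d; field; rewrite !gt_eqF.
have Q2c : 0 < 2 * Q / c by rewrite divr_gt0// mulr_gt0.
by rewrite ler_pM2l// lerDl ltW.
Qed.
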